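(* Let $\mathfrak g$ be a complex semisimple Lie algebra and $\mu\in\Lambda^+$ be such that every weight $\nu\in\Pi(\mu)$ has multiplicity one and, writing $\nu=\sum_i\nu_i\pi_i$: (1) $\nu_i\ge-2$ for all $i$; (2) there is at most one index $i$ with $\nu_i=-2$, and if there is such an $i$, then $\nu_j\ge0$ and $a_{ij}\ge-1$ for all $j\neq i$. Then for every $\lambda\in\Lambda^+$, $\mathbb V_\mu\otimes\mathbb V_\lambda\cong\bigoplus_{\tau\in A}\mathbb V_\tau$ for some subset $A\subset\{\lambda+\nu:\nu\in\Pi(\mu)\}\cap\overline{\mathcal C}$, and there are no multiplicities in the decomposition.
   Context: $\mathfrak h$ is a Cartan subalgebra with chosen positive roots, simple roots $\alpha_1,\dots,\alpha_n$, $\alpha_i^\vee=2\alpha_i/(\alpha_i,\alpha_i)$ with $(\cdot,\cdot)$ induced by the Killing form; $a_{ij}=(\alpha_i,\alpha_j^\vee)$ is the Cartan matrix; fundamental weights $\pi_j$ satisfy $(\alpha_i^\vee,\pi_j)=\delta_{ij}$, and the coefficients of a weight $\nu$ are $\nu_i=(\nu,\alpha_i^\vee)$. $\Lambda^+$ is the set of dominant integral weights, $\overline{\mathcal C}$ the closed dominant Weyl chamber, $\mathbb V_\lambda$ the irreducible representation of highest weight $\lambda$, $\Pi(\mu)$ the set of weights of $\mathbb V_\mu$. *)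

(* Defs.v *)
From HB Require Import structures.
From mathcomp Require Import all_boot all_order all_algebra.
Set Implicit Arguments. Unset Strict Implicit. Unset Printing Implicit Defensive.
Import Order.TTheory GRing.Theory Num.Theory.
Local Open Scope ring_scope.

Section LieDefs.
Variable F : fieldType.
Variable d : nat.
Variable br : 'rV[F]_d -> 'rV[F]_d -> 'rV[F]_d.

Definition is_lie_bracket : Prop :=
  [/\ (forall a x y z, br (a *: x + y) z = a *: br x z + br y z),
      (forall a x y z, br x (a *: y + z) = a *: br x y + br x z),
      (forall x, br x x = 0) &
      (forall x y z, br x (br y z) + br y (br z x) + br z (br x y) = 0)].

(* ad x, acting on row vectors on the right:  y *m ad x = [x, y]. *)
Definition ad (x : 'rV[F]_d) : 'M[F]_d := lin1_mx (br x).

Definition killing (x y : 'rV[F]_d) : F := \tr (ad x *m ad y).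

(* semisimple: the Killing form is nondegenerate (Cartan's criterion). *)
Definition semisimple : Prop :=
  forall x, (forall y, killing x y = 0) -> x = 0.

Definition subalgebra (H : 'M[F]_d) : Prop :=
  forall x y, (x <= H)%MS -> (y <= H)%MS -> (br x y <= H)%MS.

Definition toral (H : 'M[F]_d) : Prop :=
  subalgebra H /\ forall x, (x <= H)%MS -> diagonalizable (ad x).

(* Cartan subalgebra of a semisimple Lie algebra = maximal toral subalgebra *)
Definition cartan (H : 'M[F]_d) : Prop :=
  toral H /\ forall H', toral H' -> (H <= H')%MS -> (H' <= H)%MS.

(* Weights: linear functionals, represented by row vectors nu, with
   nu(x) = sum_j x_j nu_j; only their restriction to H matters. *)
Definition weval (nu x : 'rV[F]_d) : F := \sum_(j < d) x 0 j * nu 0 j.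

Definition weq (H : 'M[F]_d) (nu nu' : 'rV[F]_d) : Prop :=
  forall x, (x <= H)%MS -> weval nu x = weval nu' x.

Definition act n (rho : 'rV[F]_d -> 'M[F]_n) x (v : 'rV[F]_n) := v *m rho x.

Definition is_rep n (rho : 'rV[F]_d -> 'M[F]_n) : Prop :=
  (forall a x y, rho (a *: x + y) = a *: rho x + rho y) /\
  (forall x y v, act rho (br x y) v
                 = act rho x (act rho y v) - act rho y (act rho x v)).

(* Tensor product: V1 (x) V2 is identified with 'M_(n1,n2) (u (x) w = u^T w),
   flattened to 'rV_(n1*n2) by mxvec; x acts by x.u (x) w + u (x) x.w. *)
Definition tensor_rep n1 n2 (rho1 : 'rV[F]_d -> 'M[F]_n1)
  (rho2 : 'rV[F]_d -> 'M[F]_n2) (x : 'rV[F]_d) : 'M[F]_(n1 * n2) :=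
  lin1_mx (fun v : 'rV[F]_(n1 * n2) =>
     mxvec ((rho1 x)^T *m vec_mx v + vec_mx v *m rho2 x)).

(* weight space V_nu = {v | h.v = nu(h) v for all h in H}; it suffices to
   test the rows of H, which span H. *)
Definition wspace n (rho : 'rV[F]_d -> 'M[F]_n) (H : 'M[F]_d) (nu : 'rV[F]_d)
  : 'M[F]_n :=
  (\bigcap_(i < d) kermx (rho (row i H) - (weval nu (row i H))%:M))%MS.

Definition wmult n (rho : 'rV[F]_d -> 'M[F]_n) H nu : nat := \rank (wspace rho H nu).

Definition is_root (H : 'M[F]_d) (a : 'rV[F]_d) : Prop :=
  ~ weq H a 0 /\ wspace ad H a != 0.

Definition wcomb r (alpha : 'I_r -> 'rV[F]_d) (c : 'I_r -> F) : 'rV[F]_d :=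
  \sum_(i < r) c i *: alpha i.

Definition is_base (H : 'M[F]_d) r (alpha : 'I_r -> 'rV[F]_d) : Prop :=
  [/\ (forall i, is_root H (alpha i)),
      (forall c : 'I_r -> F, weq H (wcomb alpha c) 0 -> forall i, c i = 0) &
      (forall b, is_root H b -> exists c : 'I_r -> nat,
          weq H b (wcomb alpha (fun i => (c i)%:R)) \/
          weq H b (- wcomb alpha (fun i => (c i)%:R)))].

Definition pos_root (H : 'M[F]_d) r (alpha : 'I_r -> 'rV[F]_d) b : Prop :=
  is_root H b /\
  exists c : 'I_r -> nat, weq H b (wcomb alpha (fun i => (c i)%:R)).

Definition killing_dual (H : 'M[F]_d) (a t : 'rV[F]_d) : Prop :=
  (t <= H)%MS /\ forall x, (x <= H)%MS -> killing t x = weval a x.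

(* (nu, alpha_j^vee) = 2 (nu, alpha_j) / (alpha_j, alpha_j) = 2 nu(t_j) / alpha_j(t_j) *)
Definition wcoord r (alpha t : 'I_r -> 'rV[F]_d) (nu : 'rV[F]_d) (j : 'I_r) : F :=
  2 * weval nu (t j) / weval (alpha j) (t j).

Definition cartan_mx r (alpha t : 'I_r -> 'rV[F]_d) (i j : 'I_r) : F :=
  wcoord alpha t (alpha i) j.

Definition is_nat (c : F) : Prop := exists m : nat, c = m%:R.
Definition int_ge (c : F) (k : int) : Prop := exists z : int, (k <= z)%R /\ c = z%:~R.

(* dominant integral (equivalently, for integral weights, in the closed
   dominant chamber) *)
Definition dominant r (alpha t : 'I_r -> 'rV[F]_d) (nu : 'rV[F]_d) : Prop :=
  forall j, is_nat (wcoord alpha t nu j).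

Definition invariant n (rho : 'rV[F]_d -> 'M[F]_n) (W : 'M[F]_n) : Prop :=
  forall x, stablemx W (rho x).

Definition irreducible n (rho : 'rV[F]_d -> 'M[F]_n) (W : 'M[F]_n) : Prop :=
  [/\ invariant rho W, W != 0 &
      forall U : 'M[F]_n, invariant rho U -> (U <= W)%MS ->
        U == 0 \/ (U == W)%MS].

Definition highest_weight (H : 'M[F]_d) r (alpha : 'I_r -> 'rV[F]_d) n
  (rho : 'rV[F]_d -> 'M[F]_n) (W : 'M[F]_n) (lam : 'rV[F]_d) : Prop :=
  exists v : 'rV[F]_n,
    [/\ v != 0, (v <= W)%MS, (v <= wspace rho H lam)%MS &
        forall b e, pos_root H alpha b -> (e <= wspace ad H b)%MS ->
          act rho e v = 0].

End LieDefs.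

(* Main.v *)
Require Import Defs.
From HB Require Import structures.
From mathcomp Require Import all_boot all_order all_algebra.
From mathcomp Require Import ring.
From Stdlib Require Import Classical.
Import Order.TTheory GRing.Theory Num.Theory.
Local Open Scope ring_scope.
Set Implicit Arguments.
Unset Strict Implicit.
Unset Printing Implicit Defensive.

(* A singular vector of weight tau in V_mu (x) V_lam, contracted in the second factor
   with the functional dual to the highest weight vector of V_lam, is a vector of weight
   tau - lam of V_mu.  The contraction is injective: the row space of a singular tensor,
   viewed as a matrix, is a submodule of V_lam for the Borel subalgebra, so it contains
   the highest weight vector.  As the weights of V_mu are simple, a weight carries at most
   one singular vector, up to scalars.

   Complete reducibility comes from the Casimir element.  Its value on a highest weight
   module is strictly increasing along sigma > tau for dominant sigma and tau, because
   (alpha_i, alpha_i) and (2 rho, alpha_i) are positive rationals.  Both facts are read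
   off from traces of [e_i, f_i] on suitable sums of root spaces, and they need H to be
   its own centralizer, which is where maximality of H enters. *)

(** * Linear algebra *)

(** [cartan] means maximal toral, so self-centralization is itself a theorem here: for [x]
    centralizing [H], the semisimple part of [ad x] is an inner derivation [ad s], adjoining [s] to
    [H] gives a toral subalgebra, and maximality puts [s] in [H]; the nilpotent remainder is
    Killing-orthogonal to everything. The scalars are an algebraically closed field of
    characteristic zero and carry no order, so an inequality between Casimir values is the statement
    that a difference is a quotient of positive integers. Roots enter through a weight basis [b k]
    whose weights [w k] are repeated by multiplicity: sums over roots are then traces over basis
    vectors. Weights are compared by [weq], on [H] only. Singularity is taken modulo a submodule
    [N]: if the highest weight submodules spanned a proper [N], the quotient by [N] would have a
    singular vector, and working modulo [N] expresses this without forming the quotient. The Casimir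
    element lifts such a vector to a genuinely singular one, which lies in [N] by construction. *)

Section Subspaces.
Variables (F : fieldType) (n : nat).

Lemma sumsmx_ind (I : finType) (P : pred I) (A : I -> 'M[F]_n)
    (Q : 'rV[F]_n -> Prop) :
  Q 0 -> (forall u v, Q u -> Q v -> Q (u + v)) ->
  (forall i, P i -> forall u, (u <= A i)%MS -> Q u) ->
  forall u, (u <= \sum_(i | P i) A i)%MS -> Q u.
Proof.
move=> Q0 QD QA u /sub_sumsmxP[v ->].
by apply: big_ind => // i Pi; apply: QA Pi _ _; rewrite submxMl.
Qed.

Lemma sumsmx_seq_ind (T : eqType) (s : seq T) (A : T -> 'M[F]_n)
    (Q : 'rV[F]_n -> Prop) :
  Q 0 -> (forall u v, Q u -> Q v -> Q (u + v)) ->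
  (forall x, x \in s -> forall u, (u <= A x)%MS -> Q u) ->
  forall u, (u <= \sum_(x <- s) A x)%MS -> Q u.
Proof.
move=> Q0 QD QA u; rewrite (big_tnth _ _ s); apply: sumsmx_ind => // i _ v.
by apply: QA; apply: mem_tnth.
Qed.

Lemma sumsmx_seq_sup (T : eqType) (s : seq T) (A : T -> 'M[F]_n) x :
  x \in s -> (A x <= \sum_(y <- s) A y)%MS.
Proof.
move=> xs; rewrite (big_tnth _ _ s).
have /tnthP[i ->] : x \in in_tuple s by [].
exact: (sumsmx_sup i).
Qed.

(** The index type may be infinite, as for the family of all weight spaces: adjoining a summand that
    is not yet contained raises the rank, which is at most [n]. *)
Lemma exists_finite_sum (T : Type) (A : T -> 'M[F]_n) :
  exists s : seq T, forall t, (A t <= \sum_(x <- s) A x)%MS.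
Proof.
suff H k : forall s : seq T, (n - \rank (\sum_(x <- s) A x) < k)%N ->
    exists s : seq T, forall t, (A t <= \sum_(x <- s) A x)%MS.
  exact: (H _ [::] (leqnn _)).
elim: k => // k IHk s; rewrite ltnS => lek.
case: (classic (forall t, (A t <= \sum_(x <- s) A x)%MS)); first by exists s.
move=> /not_all_ex_not[t At]; apply: (IHk (t :: s)).
rewrite big_cons; apply: leq_trans lek.
have lt : (\rank (\sum_(x <- s) A x) < \rank (A t + \sum_(x <- s) A x))%N.
  apply: rank_ltmx; rewrite /ltmx addsmxSr /=.
  by apply/negP => le; apply: At; apply: submx_trans le; apply: addsmxSl.
by apply: ltn_sub2l => //; apply: leq_trans lt (rank_leq_row _).
Qed.

Lemma exists_span (S : 'rV[F]_n -> Prop) :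
  exists U : 'M[F]_n, (forall v, S v -> (v <= U)%MS) /\
    forall m (W : 'M[F]_(m, n)), (forall v, S v -> (v <= W)%MS) -> (U <= W)%MS.
Proof.
have [s Hs] := @exists_finite_sum {v | S v} (fun v => <<proj1_sig v>>%MS).
exists (\sum_(x <- s) <<proj1_sig x>>)%MS; split=> [v Sv|m W SW].
  by have := Hs (exist _ v Sv); rewrite genmxE.
apply: (big_ind (fun X : 'M_n => (X <= W)%MS)); first exact: sub0mx.
  by move=> X Y XW YW; rewrite addsmx_sub XW.
by case=> v Sv _; rewrite genmxE; apply: SW.
Qed.

(** Classical logic turns a linear condition into a row space, so that submodules defined by a
    property become matrices. *)
Lemma exists_subspace (Q : 'rV[F]_n -> Prop) :
  Q 0 -> (forall a u v, Q u -> Q v -> Q (a *: u + v)) ->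
  exists U : 'M[F]_n, forall v, (v <= U)%MS <-> Q v.
Proof.
move=> Q0 QL; have [s Hs] := @exists_finite_sum {v | Q v} (fun v => <<proj1_sig v>>%MS).
exists (\sum_(x <- s) <<proj1_sig x>>)%MS => v; split; last first.
  by move=> Qv; have := Hs (exist _ v Qv); rewrite genmxE.
rewrite (big_tnth _ _ s) => Hv; move: v Hv.
apply: sumsmx_ind => // [u v Qu Qv|i _ u].
  by rewrite -[u]scale1r; apply: QL.
rewrite genmxE => /sub_rVP[a ->]; rewrite -[_ *: _]addr0.
by apply: QL => //; case: (tnth _ _).
Qed.

(** The intersection of all stable subspaces through [v]; with the lowering operators for [C] it
    produces the cyclic highest weight module. *)
Lemma exists_closure (v : 'rV[F]_n) (C : 'M[F]_n -> Prop) :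
  exists U : 'M[F]_n, [/\ (v <= U)%MS, (forall A, C A -> stablemx U A) &
    forall W : 'M[F]_n, (v <= W)%MS -> (forall A, C A -> stablemx W A) -> (U <= W)%MS].
Proof.
pose Q (u : 'rV[F]_n) := forall W : 'M[F]_n, (v <= W)%MS -> (forall A, C A -> stablemx W A) ->
  (u <= W)%MS.
have [|a x y Qx Qy|U HU] := @exists_subspace Q; first by move=> W _ _; apply: sub0mx.
  by move=> W vW CW; apply: addmx_sub; [apply/scalemx_sub/Qx | apply: Qy].
exists U; split=> [|A CA|W vW CW].
- by apply/HU.
- apply/row_subP => i; rewrite row_mul; apply/HU => W vW CW.
  by apply: submx_trans (CW A CA); apply/submxMr/(proj1 (HU _) _ W) => //; apply: row_sub.
- by apply/row_subP => i; apply: (proj1 (HU _) (row_sub i U)).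
Qed.

Lemma span_ind (S Q : 'rV[F]_n -> Prop) (U : 'M[F]_n) :
  (forall m (W : 'M[F]_(m, n)), (forall v, S v -> (v <= W)%MS) -> (U <= W)%MS) ->
  Q 0 -> (forall a u v, Q u -> Q v -> Q (a *: u + v)) ->
  (forall v, S v -> Q v) -> forall u, (u <= U)%MS -> Q u.
Proof.
move=> minU Q0 QL SQ u uU; have [W HW] := exists_subspace Q0 QL.
apply/HW/(submx_trans uU); apply: minU => v /SQ Qv; exact/HW.
Qed.

(** * Eigenvalues and diagonalizable matrices *)

Lemma uniq_eigenvalues_size (A : 'M[F]_n) (s : seq F) :
  uniq s -> (forall c, c \in s -> exists2 v : 'rV_n, v *m A = c *: v & v != 0) ->
  (size s <= n)%N.
Proof.
move=> us Hs; rewrite -ltnS -(size_char_poly A); apply: max_poly_roots => //.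
  by rewrite monic_neq0 ?char_poly_monic.
apply/allP => c /Hs [v vA v0]; rewrite -eigenvalue_root_char.
by apply/eigenvalueP; exists v.
Qed.

Lemma diagonalizable_basis (A : 'M[F]_n) : diagonalizable A ->
  exists (P : 'M[F]_n) (c : 'I_n -> F), P \in unitmx /\
    forall k, row k P *m A = c k *: row k P.
Proof.
case=> P Pu /diagonalizable_forPex[D /(simmxP Pu) PA].
exists P, (fun k => D 0 k); split=> // k.
by rewrite -row_mul PA row_mul row_diag_mx -scalemxAl -rowE.
Qed.

Lemma diagonalizable_of_basis (A P : 'M[F]_n) (c : 'I_n -> F) : P \in unitmx ->
  (forall k, row k P *m A = c k *: row k P) -> diagonalizable A.
Proof.
move=> Pu PA; exists P => //; apply/diagonalizable_forPex.
exists (\row_k c k); apply/(simmxP Pu)/row_matrixP => k.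
by rewrite row_mul PA row_mul row_diag_mx mxE -scalemxAl -rowE.
Qed.

Lemma unitmx_rowP (P : 'M[F]_n) : P \in unitmx -> forall v : 'rV_n,
  exists c : 'I_n -> F, v = \sum_k c k *: row k P.
Proof.
move=> Pu v; exists (fun k => (v *m invmx P) 0 k).
by rewrite -mulmx_sum_row mulmxKV.
Qed.

Lemma unitmx_row_inj (P : 'M[F]_n) : P \in unitmx -> forall c : 'I_n -> F,
  \sum_k c k *: row k P = 0 -> forall k, c k = 0.
Proof.
move=> Pu c H0 k; have : (\row_k c k) *m P = 0.
  by rewrite mulmx_sum_row -[RHS]H0; apply: eq_bigr => i _; rewrite mxE.
move/(congr1 (mulmx^~ (invmx P))); rewrite mulmxK // mul0mx => /rowP/(_ k).
by rewrite !mxE.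
Qed.

(** On an eigenbasis, [y * c * c = 0] forces [y * c = 0]: kernel and image of a diagonalizable
    matrix meet only in 0. *)
Lemma diagonalizable_sq (A : 'M[F]_n) (v : 'rV_n) : diagonalizable A ->
  v *m A *m A = 0 -> v *m A = 0.
Proof.
case/diagonalizable_basis=> P [c [Pu PA]].
have [x ->] := unitmx_rowP Pu v.
have E (y : 'I_n -> F) : (\sum_k y k *: row k P) *m A = \sum_k (y k * c k) *: row k P.
  by rewrite mulmx_suml; apply: eq_bigr => k _; rewrite -scalemxAl PA scalerA.
rewrite !E => /unitmx_row_inj H0; apply: big1 => k _.
have /eqP := H0 Pu k; rewrite -mulrA !mulf_eq0 orbb; case: eqP => [->|_ /= /eqP->].
  by rewrite mul0r scale0r.
by rewrite mulr0 scale0r.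
Qed.

Lemma diagonalizable_subC (A : 'M[F]_n) a :
  diagonalizable A -> diagonalizable (A - a%:M).
Proof.
case/diagonalizable_basis=> P [c [Pu PA]].
apply: (@diagonalizable_of_basis _ P (fun k => c k - a)) => // k.
by rewrite mulmxBr PA mul_mx_scalar scalerBl.
Qed.

Lemma diagonalizable_exp (A : 'M[F]_n) (v : 'rV_n) a m : diagonalizable A ->
  v *m (A - a%:M) ^+ m = 0 -> v *m A = a *: v.
Proof.
move=> dA H0; apply/eqP; rewrite -subr_eq0 -mul_mx_scalar -mulmxBr; apply/eqP.
elim: m H0 => [|m IHm] H0.
  by move: H0; rewrite expr0 mulmx1 => ->; rewrite mul0mx.
case: m IHm H0 => [|m] IHm; first by rewrite expr1.
rewrite exprSr -[_ * _]/(_ *m _) mulmxA => H0; apply: IHm; rewrite exprSr -[_ * _]/(_ *m _) mulmxA.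
apply: diagonalizable_sq; first exact: diagonalizable_subC.
by move: H0; rewrite exprSr -[_ * _]/(_ *m _) !mulmxA.
Qed.

Lemma diagonalizable_add (A B : 'M[F]_n) : comm_mx A B ->
  diagonalizable A -> diagonalizable B -> diagonalizable (A + B).
Proof.
move=> cAB dA dB; have := codiagonalizableP [:: A; B].
case=> [[]] => [|P Pu /= /and3P[/diagonalizable_forPex[D1 /(simmxP Pu) E1]
   /diagonalizable_forPex[D2 /(simmxP Pu) E2] _] _].
  split=> [X Y|X]; rewrite !inE => /pred2P[]-> //; by move/pred2P=> []->.
exists P => //; apply/diagonalizable_forPex; exists (D1 + D2).
by apply/(simmxP Pu); rewrite mulmxDr E1 E2 -mulmxDl; congr (_ *m _); rewrite linearD.
Qed.

End Subspaces.

(** * Jordan decomposition over an algebraically closed field *)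

Lemma poly_crt (F : fieldType) (rs : seq F) m : uniq rs ->
  exists p : {poly F}, forall c, c \in rs -> ('X - c%:P) ^+ m %| p - c%:P.
Proof.
elim: rs => [|a rs IH] /=; first by exists 0.
case/andP=> ars /IH[p Hp]; set M := \prod_(c <- rs) ('X - c%:P) ^+ m.
have cop : coprimep M (('X - a%:P) ^+ m).
  rewrite /M big_seq; apply: (big_ind (fun q => coprimep q _)); first exact: coprime1p.
    by move=> q r cq cr; rewrite coprimepMl cq.
  move=> c crs; rewrite coprimep_expl // coprimep_expr // coprimep_XsubC root_XsubC.
  by apply: contraNneq ars => ->.
have [[u v] /= uv] := Bezout_eq1_coprimepP _ _ cop.
(* [u * M] is 0 modulo the powers attached to [rs] and 1 modulo [('X - a%:P) ^+ m], so the
   correction changes only the residue at the new root. *)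
exists (p + u * M * (a%:P - p)) => c; rewrite inE => /predU1P[->|crs].
  have -> : p + u * M * (a%:P - p) - a%:P = v * ('X - a%:P) ^+ m * (p - a%:P).
    have -> : u * M = 1 - v * ('X - a%:P) ^+ m by rewrite -uv addrK.
    by ring.
  by rewrite -mulrA dvdp_mull // dvdp_mulr.
rewrite addrAC dvdp_add ?Hp // dvdp_mulr // dvdp_mull //.
by rewrite /M (big_rem c) //= dvdp_mulr.
Qed.

Section Closed.
Variables (F : closedFieldType) (n : nat).

Lemma eigenvector_stable (U : 'M[F]_n) (A : 'M[F]_n) : stablemx U A -> U != 0 ->
  exists (v : 'rV_n) c, [/\ v != 0, (v <= U)%MS & v *m A = c *: v].
Proof.
move=> sUA U0; have r0 : (0 < \rank U)%N by rewrite lt0n mxrank_eq0.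
have sBA : stablemx (row_base U) A by rewrite stablemx_row_base.
have [c] : exists c, root (char_poly (restrictmx U A)) c.
  by apply/closed_rootP; rewrite size_char_poly eqSS -lt0n.
rewrite -eigenvalue_root_char => /eigenvalueP[w wA w0].
exists (w *m row_base U), c; split.
- by rewrite mulmx_free_eq0 ?row_base_free.
- by apply: submx_trans (submxMl _ _) _; rewrite eq_row_base.
- have E : row_base U *m A = restrictmx U A *m row_base U.
    by rewrite mulmxKpV.
  by rewrite -mulmxA E mulmxA wA scalemxAl.
Qed.

(** Every eigenvalue of [A] is 0, so the characteristic polynomial is ['X^n], whose coefficient of
    index [n.-1] is minus the trace. *)
Lemma mxtrace_nilpotent (A : 'M[F]_n) m : A ^+ m = 0 -> \tr A = 0.
Proof.
move=> Am; case: (posnP n) => [n0|n_gt0].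
  by apply: big1 => i; have := ltn_ord i; rewrite {2}n0.
have [rs Ers] := closed_field_poly_normal (char_poly A).
have E : char_poly A = 'X^n.
  rewrite {1}Ers (monicP (char_poly_monic A)) scale1r.
  rewrite (eq_big_seq (fun _ => 'X)).
    have : size (char_poly A) = n.+1 by rewrite size_char_poly.
    rewrite Ers (monicP (char_poly_monic A)) scale1r size_prod_XsubC => -[<-].
    by rewrite big_const_seq count_predT iter_mulr_1.
  move=> z zrs; suff -> : z = 0 by rewrite subr0.
  have : root (char_poly A) z.
    by rewrite Ers (monicP (char_poly_monic A)) scale1r root_prod_XsubC.
  rewrite -eigenvalue_root_char => /eigenvalueP[v vA v0].
  have : v *m A ^+ m = z ^+ m *: v.
    elim: (m) => [|k IH]; first by rewrite !expr0 mulmx1 scale1r.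
    by rewrite exprSr -[_ * _]/(_ *m _) mulmxA IH -scalemxAl vA scalerA exprSr.
  rewrite Am mulmx0 => /esym/eqP; rewrite scaler_eq0 (negPf v0) orbF.
  by rewrite expf_eq0 => /andP[_ /eqP].
have := char_poly_trace A n_gt0; rewrite E coefXn.
have -> : (n.-1 == n)%N = false by rewrite -{2}(prednK n_gt0) ltn_eqF.
by move=> /eqP; rewrite eq_sym oppr_eq0 => /eqP.
Qed.

End Closed.

(** [S] is a polynomial in [A], whence the last clause. This polynomial has residue [c] modulo a
    high power of ['X - c] for each eigenvalue [c], so [S] acts as [c] on the generalized eigenspace
    of [c]. *)
Lemma jordan_decomposition (F : closedFieldType) n (A : 'M[F]_n) :
  exists S : 'M[F]_n, [/\ diagonalizable S, (A - S) ^+ n = 0 &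
    forall B, comm_mx A B -> comm_mx S B].
Proof.
case: n A => [|n] A.
  exists 0; split; first exact: diagonalizable0.
    by apply/matrixP; case.
  by move=> B _; apply/matrixP; case.
have [rs Ers] := closed_field_poly_normal (char_poly A).
rewrite (monicP (char_poly_monic A)) scale1r in Ers.
have srs : size rs = n.+1.
  by have := size_char_poly A; rewrite Ers size_prod_XsubC => -[].
pose us := undup rs; have uus : uniq us by rewrite undup_uniq.
have [p Hp] := poly_crt n.+1 uus.
pose q := \prod_(c <- us) ('X - c%:P).
(* Multiplicities are at most [n.+1], so the minimal polynomial divides [q ^+ n.+1]. This power
   divides the product of the [p - c], which gives a squarefree annihilator of [S], and it divides
   [('X - p) ^+ n.+1], which gives nilpotency of [A - S]. *)
have dq : char_poly A %| q ^+ n.+1.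
  rewrite Ers -srs.
  have : {subset rs <= us} by move=> z; rewrite mem_undup.
  elim: (rs) => [_|z s IH sub]; first by rewrite big_nil dvd1p.
  rewrite big_cons exprS dvdp_mul //; last by apply: IH => x xs; apply: sub; rewrite inE xs orbT.
  by rewrite dvdp_XsubCl root_prod_XsubC sub ?mem_head.
have dm : mxminpoly A %| q ^+ n.+1 by apply: dvdp_trans dq; apply: mxminpoly_dvd_char.
exists (horner_mx A p); split.
- apply: (proj2 (diagonalizableP _)); exists us; [exact: uus | rewrite dvd_mxminpoly].
  have -> : horner_mx (horner_mx A p) (\prod_(x <- us) ('X - x%:P))
          = horner_mx A (\prod_(x <- us) (p - x%:P)).
    rewrite !rmorph_prod; apply: eq_bigr => c _.
    by rewrite rmorphB [RHS]rmorphB /= horner_mx_X !horner_mx_C.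
  rewrite -dvd_mxminpoly; apply: dvdp_trans dm _.
  rewrite /q -prodrXl big_seq [X in _ %| X]big_seq.
  apply: (big_ind2 (fun x y => x %| y)) => [|x1 x2 y1 y2|c] //; first exact: dvdp_mul.
  exact: Hp.
- have -> : A - horner_mx A p = horner_mx A ('X - p) by rewrite rmorphB /= horner_mx_X.
  have dXp : q %| 'X - p.
    apply: uniq_roots_dvdp; last by rewrite uniq_rootsE.
    apply/allP => c cus; rewrite -dvdp_XsubCl.
    have -> : 'X - p = ('X - c%:P) - (p - c%:P) by rewrite opprB addrA subrK.
    by apply: dvdp_sub => //; apply: dvdp_trans (Hp _ cus); rewrite exprS dvdp_mulr.
  have := dvdp_trans dm (dvdp_exp2r n.+1 dXp); move/mxminpoly_minP.
  by rewrite rmorphXn.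
- by move=> B cAB; apply: comm_horner_mx.
Qed.

Lemma mul_lin1_mx (F : fieldType) m n (f : 'rV[F]_m -> 'rV[F]_n) :
  (forall a x y, f (a *: x + y) = a *: f x + f y) ->
  forall v, v *m lin1_mx f = f v.
Proof.
move=> Hf v; pose L : {linear 'rV[F]_m -> 'rV[F]_n} :=
  HB.pack f (GRing.isLinear.Build _ _ _ _ f Hf).
exact: (mul_rV_lin1 L).
Qed.

Lemma diagonalizable_scale (F : fieldType) n (A : 'M[F]_n) a :
  diagonalizable A -> diagonalizable (a *: A).
Proof.
case/diagonalizable_basis=> P [c [Pu PA]].
apply: (@diagonalizable_of_basis _ _ _ P (fun k => a * c k)) => // k.
by rewrite -scalemxAr PA scalerA.
Qed.

(** * Weights and representations *)

Section Weval.
Variables (F : fieldType) (d : nat).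
Implicit Types x y nu : 'rV[F]_d.

Lemma wevalE nu x : weval nu x = (x *m nu^T) 0 0.
Proof. by rewrite mxE; apply: eq_bigr => j _; rewrite mxE. Qed.

Lemma weval_linr nu a x y : weval nu (a *: x + y) = a * weval nu x + weval nu y.
Proof. by rewrite !wevalE mulmxDl -scalemxAl !mxE. Qed.

Lemma weval_linl x a nu nu' : weval (a *: nu + nu') x = a * weval nu x + weval nu' x.
Proof. by rewrite !wevalE linearD linearZ mulmxDr -scalemxAr !mxE. Qed.

Lemma wevalDl x nu nu' : weval (nu + nu') x = weval nu x + weval nu' x.
Proof. by rewrite -[nu]scale1r weval_linl scale1r mul1r. Qed.

Lemma wevalDr nu x y : weval nu (x + y) = weval nu x + weval nu y.
Proof. by rewrite -[x]scale1r weval_linr scale1r mul1r. Qed.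

Lemma weval0l x : weval 0 x = 0.
Proof. by rewrite wevalE trmx0 mulmx0 mxE. Qed.

Lemma weval0r nu : weval nu 0 = 0.
Proof. by rewrite wevalE mul0mx mxE. Qed.

Lemma wevalZl x a nu : weval (a *: nu) x = a * weval nu x.
Proof. by rewrite -[_ *: _]addr0 weval_linl weval0l addr0. Qed.

Lemma wevalZr nu a x : weval nu (a *: x) = a * weval nu x.
Proof. by rewrite -[_ *: _]addr0 weval_linr weval0r addr0. Qed.

Lemma wevalNl x nu : weval (- nu) x = - weval nu x.
Proof. by rewrite -scaleN1r wevalZl mulN1r. Qed.

Lemma weval_sumr (I : Type) (s : seq I) (P : pred I) nu (f : I -> 'rV[F]_d) :
  weval nu (\sum_(i <- s | P i) f i) = \sum_(i <- s | P i) weval nu (f i).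
Proof. by apply: (big_morph (weval nu)) => [x y|]; rewrite ?wevalDr ?weval0r. Qed.

Lemma weval_suml (I : Type) (s : seq I) (P : pred I) x (f : I -> 'rV[F]_d) :
  weval (\sum_(i <- s | P i) f i) x = \sum_(i <- s | P i) weval (f i) x.
Proof.
by apply: (big_morph (fun nu => weval nu x)) => [u v|]; rewrite ?wevalDl ?weval0l.
Qed.

Lemma functional_weval (g : 'rV[F]_d -> F) :
  (forall a x y, g (a *: x + y) = a * g x + g y) ->
  exists nu, forall x, weval nu x = g x.
Proof.
move=> gL; have g0 : g 0 = 0.
  by have := gL (-1) 0 0; rewrite scaler0 addr0 mulN1r addNr.
have gD x y : g (x + y) = g x + g y by rewrite -[x]scale1r gL scale1r mul1r.
exists (\row_j g (delta_mx 0 j)) => x.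
rewrite [x in RHS]row_sum_delta (big_morph g gD g0); apply: eq_bigr => j _.
by rewrite -[_ *: _]addr0 gL g0 addr0 mxE.
Qed.
End Weval.

Section Rep.
Variables (F : fieldType) (d : nat) (br : 'rV[F]_d -> 'rV[F]_d -> 'rV[F]_d).
Variables (n : nat) (rho : 'rV[F]_d -> 'M[F]_n) (Hrho : is_rep br rho).

Lemma rep_lin a x y : rho (a *: x + y) = a *: rho x + rho y.
Proof. by case: Hrho => ->. Qed.
Lemma repD x y : rho (x + y) = rho x + rho y.
Proof. by rewrite -[x]scale1r rep_lin !scale1r. Qed.
Lemma rep0 : rho 0 = 0.
Proof. by have := rep_lin (-1) 0 0; rewrite scaler0 addr0 scaleN1r addNr. Qed.
Lemma repZ a x : rho (a *: x) = a *: rho x.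
Proof. by rewrite -[_ *: _]addr0 rep_lin rep0 addr0. Qed.
Lemma repN x : rho (- x) = - rho x.
Proof. by rewrite -scaleN1r repZ scaleN1r. Qed.
Lemma repB x y : rho (x - y) = rho x - rho y.
Proof. by rewrite repD repN. Qed.
Lemma rep_sum (I : Type) (s : seq I) (P : pred I) (f : I -> 'rV[F]_d) :
  rho (\sum_(i <- s | P i) f i) = \sum_(i <- s | P i) rho (f i).
Proof. by apply: (big_morph rho) => [x y|]; rewrite ?repD ?rep0. Qed.
Lemma rep_br x y : rho (br x y) = rho y *m rho x - rho x *m rho y.
Proof.
apply/row_matrixP => i; rewrite !rowE mulmxBr !mulmxA.
by case: Hrho => _ /(_ x y (delta_mx 0 i)).
Qed.

Lemma wspaceP (H : 'M[F]_d) nu (v : 'rV_n) :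
  (v <= wspace rho H nu)%MS <-> forall h, (h <= H)%MS -> v *m rho h = weval nu h *: v.
Proof.
split=> [/sub_bigcapmxP Hv _ /submxP[c ->]|Hv].
  rewrite [c *m H]mulmx_sum_row rep_sum weval_sumr mulmx_sumr scaler_suml.
  apply: eq_bigr => i _; rewrite repZ wevalZr -scalemxAr -scalerA; congr (_ *: _).
  have /sub_kermxP := Hv i isT.
  by rewrite mulmxBr mul_mx_scalar => /eqP; rewrite subr_eq0 => /eqP.
apply/sub_bigcapmxP => i _; apply/sub_kermxP.
by rewrite mulmxBr mul_mx_scalar Hv ?subrr // row_sub.
Qed.

Lemma wspace_weq (H : 'M[F]_d) nu nu' : weq H nu nu' -> wspace rho H nu = wspace rho H nu'.
Proof. by move=> E; apply: eq_bigr => i _; rewrite E ?row_sub. Qed.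
End Rep.

(** * Structure of the Lie algebra *)

Section Lie.
Variables (F : closedFieldType) (charF0 : [pchar F] =i pred0).
Variables (d : nat) (br : 'rV[F]_d -> 'rV[F]_d -> 'rV[F]_d).
Hypotheses (Hlie : is_lie_bracket br) (Hss : semisimple br).
Implicit Types x y z : 'rV[F]_d.
Notation ad := (ad br).
Notation kil := (killing br).

Lemma natF_neq0 m : (m%:R != 0 :> F) = (m != 0%N).
Proof.
apply/idP/idP; first by apply: contraNneq => ->.
by rewrite natf_neq0_pchar => m0; case: m m0 => // m _; apply/pnatP => // p _ _; rewrite inE /= charF0.
Qed.

Lemma natF_eq0 m : (m%:R == 0 :> F) = (m == 0%N).
Proof. by rewrite -[LHS]negbK natF_neq0 negbK. Qed.

Lemma adE x y : y *m ad x = br x y.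
Proof. by rewrite mul_lin1_mx //; case: Hlie => _ H _ _ a u v; apply: H. Qed.

Lemma brxx x : br x x = 0. Proof. by case: Hlie. Qed.

Lemma ad_lin a x y : ad (a *: x + y) = a *: ad x + ad y.
Proof.
apply/row_matrixP => i; rewrite !rowE mulmxDr -scalemxAr !adE.
by case: Hlie.
Qed.

Lemma br_anti x y : br y x = - br x y.
Proof.
apply/eqP; rewrite -addr_eq0; apply/eqP.
have := brxx (x + y); rewrite -adE -[x in ad (x + _)]scale1r ad_lin scale1r.
by rewrite mulmxDl !mulmxDr !adE !brxx add0r addr0 addrC.
Qed.

Lemma ad_rep : is_rep br ad.
Proof.
split=> [|x y v]; first exact: ad_lin.
rewrite /act !adE; case: Hlie => _ _ _ /(_ x y v).
rewrite [br (br x y) v]br_anti => /eqP; rewrite addrC addr_eq0 => /eqP ->.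
by rewrite opprK (br_anti x v); congr (_ + _); rewrite -[LHS]adE mulNmx adE.
Qed.

Lemma brDl x y z : br (x + y) z = br x z + br y z.
Proof. by rewrite -!adE (repD ad_rep) mulmxDr. Qed.
Lemma brDr x y z : br x (y + z) = br x y + br x z.
Proof. by rewrite -!adE mulmxDl. Qed.
Lemma brZl a x y : br (a *: x) y = a *: br x y.
Proof. by rewrite -!adE (repZ ad_rep) -scalemxAr. Qed.
Lemma brZr a x y : br x (a *: y) = a *: br x y.
Proof. by rewrite -!adE -scalemxAl. Qed.
Lemma br0r x : br x 0 = 0.
Proof. by rewrite -adE mul0mx. Qed.
Lemma br0l x : br 0 x = 0.
Proof. by rewrite -adE (rep0 ad_rep) mulmx0. Qed.
Lemma br_jacobi x y z : br x (br y z) = br (br x y) z + br y (br x z).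
Proof.
by rewrite -[br (br x y) z]adE (rep_br ad_rep) mulmxBr !mulmxA !adE subrK.
Qed.

(** * The Killing form and derivations *)

Lemma kilC x y : kil x y = kil y x.
Proof. by rewrite /killing mxtrace_mulC. Qed.
Lemma kil_linr x a y z : kil x (a *: y + z) = a * kil x y + kil x z.
Proof. by rewrite /killing ad_lin mulmxDr -scalemxAr linearD linearZ. Qed.
Lemma kil_linl z a x y : kil (a *: x + y) z = a * kil x z + kil y z.
Proof. by rewrite kilC kil_linr !(kilC z). Qed.
Lemma kilDr x y z : kil x (y + z) = kil x y + kil x z.
Proof. by rewrite -[y]scale1r kil_linr scale1r mul1r. Qed.
Lemma kilDl x y z : kil (x + y) z = kil x z + kil y z.
Proof. by rewrite kilC kilDr !(kilC z). Qed.
Lemma kil0r x : kil x 0 = 0.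
Proof. by rewrite /killing (rep0 ad_rep) mulmx0 linear0. Qed.
Lemma kilZr x a y : kil x (a *: y) = a * kil x y.
Proof. by rewrite -[_ *: _]addr0 kil_linr kil0r addr0. Qed.
Lemma kilZl x a y : kil (a *: x) y = a * kil x y.
Proof. by rewrite kilC kilZr kilC. Qed.
Lemma kil_sumr (I : Type) (s : seq I) (P : pred I) x (f : I -> 'rV[F]_d) :
  kil x (\sum_(i <- s | P i) f i) = \sum_(i <- s | P i) kil x (f i).
Proof. by apply: (big_morph (kil x)) => [u v|]; rewrite ?kilDr ?kil0r. Qed.
Lemma kil_suml (I : Type) (s : seq I) (P : pred I) x (f : I -> 'rV[F]_d) :
  kil (\sum_(i <- s | P i) f i) x = \sum_(i <- s | P i) kil (f i) x.
Proof. by rewrite kilC kil_sumr; apply: eq_bigr => i _; rewrite kilC. Qed.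

Lemma kil_inv x y z : kil (br x y) z = kil x (br y z).
Proof.
rewrite /killing !(rep_br ad_rep) mulmxBl mulmxBr !linearB /= -!mulmxA.
by rewrite [\tr (ad y *m _)]mxtrace_mulC -!mulmxA.
Qed.

Lemma kil_nondeg x y : (forall z, kil x z = kil y z) -> x = y.
Proof.
move=> E; apply/eqP; rewrite -subr_eq0; apply/eqP/Hss => z.
by rewrite -scaleN1r addrC kil_linl mulN1r E addNr.
Qed.

Lemma ad_inj x y : ad x = ad y -> x = y.
Proof. by move=> E; apply: kil_nondeg => z; rewrite /killing E. Qed.

Lemma kil_repr nu : exists s, forall y, kil s y = weval nu y.
Proof.
pose K := \matrix_(i < d, j < d) kil (delta_mx 0 i) (delta_mx 0 j).
have KE x y : kil x y = (x *m K *m y^T) 0 0.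
  rewrite {1}[x]row_sum_delta kil_suml [(_ *m _) 0 0]mxE.
  under [RHS]eq_bigr do rewrite !mxE mulr_suml.
  rewrite [RHS]exchange_big; apply: eq_bigr => i _ /=.
  rewrite kilZl {1}[y]row_sum_delta kil_sumr mulr_sumr.
  by apply: eq_bigr => j _; rewrite kilZr !mxE; ring.
have Ku : K \in unitmx.
  rewrite -row_free_unit -kermx_eq0; apply/eqP/row_matrixP => i; rewrite row0.
  apply: Hss => y; have : (row i (kermx K) <= kermx K)%MS by apply: row_sub.
  by rewrite KE => /sub_kermxP ->; rewrite mul0mx mxE.
exists (nu *m invmx K) => y; rewrite KE mulmxKV // wevalE.
by rewrite -[nu *m y^T]trmxK trmx_mul trmxK [LHS]mxE.
Qed.

(** Nondegeneracy represents the functional [y |-> \tr (D *m ad y)] by some [s]. The difference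
    [E = D - ad s] is again a derivation and is trace-orthogonal to every [ad y]; then
    [kil (x *m E) z] is the trace of [E] against [ad (br x z)], which is 0. *)
Lemma derivation_inner (D : 'M[F]_d) :
  (forall x y, br x y *m D = br (x *m D) y + br x (y *m D)) ->
  exists s, D = ad s.
Proof.
move=> HD.
have [nu Hnu] : exists nu, forall y, weval nu y = \tr (D *m ad y).
  apply: functional_weval => a x y.
  by rewrite ad_lin mulmxDr -scalemxAr linearD linearZ.
have [s Hs] := kil_repr nu; exists s.
have [E EE] : exists E, E = D - ad s by exists (D - ad s).
have trE y : \tr (E *m ad y) = 0.
  by rewrite EE mulmxBl linearB /= -/(killing br s y) Hs Hnu subrr.
have derE x y : br x y *m E = br (x *m E) y + br x (y *m E).
  rewrite EE !mulmxBr HD !adE br_jacobi !brDl !brDr -!scaleN1r brZl brZr.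
  by rewrite scalerDr addrACA.
have adE' y : ad (y *m E) = ad y *m E - E *m ad y.
  apply/row_matrixP => i; rewrite !rowE mulmxBr !mulmxA !adE derE addrK //.
suff E0 : E = 0 by apply/eqP; rewrite -subr_eq0 -EE E0.
apply/row_matrixP => i; rewrite row0 rowE; apply: Hss => z.
rewrite /killing adE' mulmxBl linearB /= -!mulmxA mxtrace_mulC -!mulmxA -linearB /=.
by rewrite -mulmxBr -(rep_br ad_rep) trE.
Qed.

(** Brackets add generalized eigenvalues of [ad x], and [S] is the scalar [a] on the generalized
    eigenspace of [a]; so the Leibniz rule holds on an eigenbasis of [S]. *)
Lemma jordan_derivation x (S : 'M[F]_d) : diagonalizable S ->
  (ad x - S) ^+ d = 0 -> comm_mx (ad x) S ->
  forall y z, br y z *m S = br (y *m S) z + br y (z *m S).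
Proof.
move=> dS nS cS.
have [P [c [Pu PS]]] := diagonalizable_basis dS.
have gen k : row k P *m (ad x - (c k)%:M) ^+ d = 0.
  have cc : GRing.comm (ad x - S) S.
    by rewrite /GRing.comm mulrBl mulrBr; congr (_ - _); exact: cS.
  suff E m : row k P *m (ad x - (c k)%:M) ^+ m = row k P *m (ad x - S) ^+ m.
    by rewrite E nS mulmx0.
  have step m' : row k P *m (ad x - S) ^+ m' *m S = c k *: (row k P *m (ad x - S) ^+ m').
    have /(@commrX _ _ _ m') e : GRing.comm S (ad x - S) by apply: commr_sym.
    rewrite -mulmxA -[_ ^+ _ *m S]/(_ ^+ _ * S) -e -[_ * _]/(_ *m _) mulmxA PS.
    by rewrite scalemxAl.
  elim: m => [|m IH]; first by rewrite !expr0.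
  rewrite !exprSr -![_ * _]/(_ *m _) !mulmxA IH !mulmxBr step.
  by rewrite mul_mx_scalar.
(* Induction on the sum of the exponents: [ad x - (a + a')] applied to a bracket applies [ad x - a]
   to the left entry plus [ad x - a'] to the right one. *)
have brgen a a' m m' : forall u v : 'rV_d, u *m (ad x - a%:M) ^+ m = 0 ->
    v *m (ad x - a'%:M) ^+ m' = 0 ->
    br u v *m (ad x - (a + a')%:M) ^+ (m + m') = 0.
  move: {2}(m + m')%N (erefl (m + m')%N) => N; elim: N m m' => [|N IH] m m'.
    move=> /eqP; rewrite addn_eq0 => /andP[/eqP-> /eqP->] u v.
    by rewrite expr0 mulmx1 => -> _; rewrite br0l mul0mx.
  move=> EN u v Hu Hv.
  have step : br u v *m (ad x - (a + a')%:M) =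
      br (u *m (ad x - a%:M)) v + br u (v *m (ad x - a'%:M)).
    rewrite !mulmxBr !mul_mx_scalar !adE br_jacobi !brDl !brDr -!scaleN1r !scalerA.
    rewrite !brZl !brZr !mulN1r opprD scalerDl.
    by rewrite addrACA.
  rewrite EN exprS -[_ * _]/(_ *m _) mulmxA step mulmxDl.
  case: m Hu EN => [|m] Hu EN.
    by rewrite expr0 mulmx1 in Hu; rewrite Hu mul0mx !br0l !mul0mx addr0.
  case: m' Hv EN => [|m'] Hv EN.
    by rewrite expr0 mulmx1 in Hv; rewrite Hv mul0mx !br0r !mul0mx addr0.
  have E1 : (m + m'.+1)%N = N by move: EN; rewrite addSn => -[].
  have E2 : (m.+1 + m')%N = N by move: EN; rewrite addnS => -[].
  rewrite -{1}E1 -E2 (IH m m'.+1) // ?(IH m.+1 m') ?addr0 //.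
    by rewrite -mulmxA -[_ *m _ ^+ _]/(_ * _ ^+ _) -exprS.
  by rewrite -mulmxA -[_ *m _ ^+ _]/(_ * _ ^+ _) -exprS.
have basis k l : br (row k P) (row l P) *m S = (c k + c l) *: br (row k P) (row l P).
  have nc : GRing.comm (ad x - S) (ad x - (c k + c l)%:M).
    apply: commrB; last exact: comm_mx_scalar.
    by apply/commr_sym/commrB; [exact: commr_refl | exact: cS].
  (* [S - (c k + c l)] is a difference of two commuting terms; [d + d] copies of the first kill the
     bracket and [d] copies of the second vanish, so every binomial term of the power [d + (d + d)]
     is 0. *)
  apply: (@diagonalizable_exp _ _ _ _ _ (d + (d + d))) => //.
  have -> : S - (c k + c l)%:M = (ad x - (c k + c l)%:M) - (ad x - S).
    by rewrite opprB [RHS]addrC addrA subrK.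
  have -> : ((ad x - (c k + c l)%:M) - (ad x - S)) ^+ (d + (d + d)) =
     \sum_(i < (d + (d + d)).+1) ((ad x - (c k + c l)%:M) ^+ (d + (d + d) - i) *
        (- (ad x - S)) ^+ i) *+ 'C(d + (d + d), i).
    by rewrite exprDn_comm //; apply: commrN; apply: commr_sym.
  rewrite mulmx_sumr big1 // => i _; rewrite (raddfMn (mulmx _)) /=.
  case: (leqP d i) => di.
    by rewrite [(- _) ^+ i]exprNn -(subnK di) [(ad x - S) ^+ _]exprD nS !mulr0 mulmx0 mul0rn.
  have dd : (d + d <= d + (d + d) - i)%N.
    by rewrite leq_subRL ?leq_add2r ?(ltnW di) // (leq_trans (ltnW di)) // leq_addr.
  rewrite -(subnKC dd) exprD -mulrA -[_ * _]/(_ *m _) mulmxA brgen ?gen //.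
  by rewrite mul0mx mul0rn.
move=> y z; have [u ->] := unitmx_rowP Pu y; have [v ->] := unitmx_rowP Pu z.
have sl (I : Type) (s : seq I) (Q : pred I) (f : I -> 'rV[F]_d) t :
  br (\sum_(i <- s | Q i) f i) t = \sum_(i <- s | Q i) br (f i) t.
  by apply: (big_morph (fun q => br q t)) => [p q|]; rewrite ?brDl ?br0l.
have sr (I : Type) (s : seq I) (Q : pred I) (f : I -> 'rV[F]_d) t :
  br t (\sum_(i <- s | Q i) f i) = \sum_(i <- s | Q i) br t (f i).
  by rewrite -adE mulmx_suml; apply: eq_bigr => i _; rewrite adE.
rewrite !mulmx_suml !sl !mulmx_suml -big_split /=; apply: eq_bigr => k _.
rewrite !sr !mulmx_suml -big_split /=; apply: eq_bigr => l _.
rewrite -!scalemxAl !brZl !brZr !PS !brZl !brZr -!scalemxAl basis !scalerA -scalerDl.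
by congr (_ *: _); ring.
Qed.

(** * The Cartan subalgebra and a basis of weight vectors *)

Variables (H : 'M[F]_d) (HH : cartan br H).

Lemma H_diag h : (h <= H)%MS -> diagonalizable (ad h).
Proof. by case: HH => -[_ HD] _; apply: HD. Qed.

(** If [ad x] does not vanish on [H], it has an eigenvector [v] inside its image on [H], with
    nonzero eigenvalue [c] because [ad x] is diagonalizable. Then [ad v] maps [x] to [- (c *: v)]
    and kills [v], which diagonalizability of [ad v] forbids. *)
Lemma H_abelian x y : (x <= H)%MS -> (y <= H)%MS -> br x y = 0.
Proof.
move=> xH yH; have dx := H_diag xH.
have HA : (H *m ad x <= H)%MS.
  apply/row_subP => i; rewrite row_mul adE.
  by case: HH => -[sH _] _; apply: sH => //; apply: row_sub.
have [U0|U0] := eqVneq (H *m ad x) 0.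
  by case/submxP: yH => c ->; rewrite -adE -mulmxA U0 mulmx0.
have sU : stablemx (H *m ad x) (ad x) by apply: submxMr.
have [v [c [v0 vU vc]]] := eigenvector_stable sU U0.
have vH := submx_trans vU HA; have dv := H_diag vH.
have c0 : c != 0.
  apply: contraNneq v0 => c0; case/submxP: vU vc => z ->; rewrite c0 scale0r mulmxA.
  by move=> /(diagonalizable_sq dx) ->.
have xv : x *m ad v = - (c *: v) by rewrite adE br_anti -adE vc.
have : x *m ad v = 0.
  by apply: diagonalizable_sq => //; rewrite xv mulNmx -scalemxAl adE brxx scaler0 oppr0.
by rewrite xv => /eqP; rewrite oppr_eq0 scaler_eq0 (negPf c0) (negPf v0).
Qed.

Lemma ad_H_comm x y : (x <= H)%MS -> (y <= H)%MS -> comm_mx (ad x) (ad y).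
Proof.
move=> xH yH; apply/eqP; rewrite eq_sym -subr_eq0 -(rep_br ad_rep).
by rewrite H_abelian // (rep0 ad_rep).
Qed.

Lemma weight_basis : exists (P : 'M[F]_d) (w : 'I_d -> 'rV[F]_d), P \in unitmx /\
  forall k h, (h <= H)%MS -> br h (row k P) = weval (w k) h *: row k P.
Proof.
have [cd _] := codiagonalizableP [seq ad (row i H) | i <- enum 'I_d].
have [|P Pu /allP PD] := cd.
  split=> [A B|A]; last by case/mapP=> i _ ->; apply/H_diag/row_sub.
  by case/mapP=> i _ -> /mapP[j _ ->]; apply: ad_H_comm; apply: row_sub.
have PDi i : exists D : 'rV_d, P *m ad (row i H) = diag_mx D *m P.
  have /PD /diagonalizable_forPex[D /(simmxP Pu) E] :
    ad (row i H) \in [seq ad (row i H) | i <- enum 'I_d] by apply/mapP; exists i; rewrite ?mem_enum.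
  by exists D.
have [D HD] := fin_all_exists PDi.
have Hw k : exists nu, forall x, weval nu x = (P *m ad x *m invmx P) k k.
  apply: functional_weval => a x y.
  by rewrite ad_lin mulmxDr mulmxDl -scalemxAr -scalemxAl !mxE.
have [w {}Hw] := fin_all_exists Hw.
exists P, w; split=> // k h /submxP[c ->]; rewrite Hw -adE -row_mul.
have -> : P *m ad (c *m H) = diag_mx (\sum_i c 0 i *: D i) *m P.
  rewrite mulmx_sum_row (rep_sum ad_rep) mulmx_sumr linear_sum mulmx_suml.
  by apply: eq_bigr => i _; rewrite (repZ ad_rep) -scalemxAr HD scalemxAl linearZ.
by rewrite mulmxK // row_mul row_diag_mx -scalemxAl -rowE !mxE eqxx mulr1n.
Qed.

Variables (P : 'M[F]_d) (w : 'I_d -> 'rV[F]_d) (Pu : P \in unitmx).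
Hypothesis Pw : forall k h, (h <= H)%MS -> br h (row k P) = weval (w k) h *: row k P.
Notation b k := (row k P).

Definition weqb nu nu' := [forall i, weval nu (row i H) == weval nu' (row i H)].

Lemma weqP nu nu' : reflect (weq H nu nu') (weqb nu nu').
Proof.
apply: (iffP forallP) => [E x /submxP[c ->]|E i]; last by rewrite E ?row_sub.
rewrite mulmx_sum_row !weval_sumr; apply: eq_bigr => i _.
by rewrite !wevalZr (eqP (E i)).
Qed.

Lemma weqNP nu nu' : ~~ weqb nu nu' -> exists2 h, (h <= H)%MS & weval nu h != weval nu' h.
Proof. by rewrite negb_forall => /existsP[i]; exists (row i H); rewrite ?row_sub. Qed.

Lemma ad_wspaceP nu x : (x <= wspace ad H nu)%MS <->
  forall h, (h <= H)%MS -> br h x = weval nu h *: x.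
Proof.
split=> [/(wspaceP ad_rep) E h /E|E]; first by rewrite adE.
by apply/(wspaceP ad_rep) => h /E; rewrite adE.
Qed.

Lemma b_wspace k : (b k <= wspace ad H (w k))%MS.
Proof. by apply/ad_wspaceP => h; apply: Pw. Qed.

Lemma b_neq0 k : b k != 0.
Proof.
apply/eqP => b0; have /unitmx_row_inj : \sum_j (j == k)%:R *: b j = 0.
  by rewrite (bigD1 k) //= eqxx scale1r b0 add0r big1 // => j /negPf->; rewrite scale0r.
by move=> /(_ Pu k)/eqP; rewrite eqxx oner_eq0.
Qed.

Lemma coord_wspace nu x (c : 'I_d -> F) : x = \sum_k c k *: b k ->
  (x <= wspace ad H nu)%MS -> forall k, c k != 0 -> weq H (w k) nu.
Proof.
move=> Ex /ad_wspaceP xnu k ck; apply/weqP; apply/negPn/negP => /weqNP[h hH /eqP].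
apply; have : \sum_j (c j * (weval (w j) h - weval nu h)) *: b j = 0.
  have := xnu h hH; rewrite -adE Ex mulmx_suml scaler_sumr => /eqP.
  rewrite -subr_eq0 -sumrB => /eqP E0; apply: etrans E0; apply: eq_bigr => j _.
  by rewrite -scalemxAl adE Pw // !scalerA -scalerBl mulrBr [c j * weval nu h]mulrC.
move/unitmx_row_inj => /(_ Pu k)/eqP; rewrite mulf_eq0 (negPf ck) subr_eq0 /=.
by move/eqP.
Qed.

Definition proj (S : pred 'I_d) :=
  locked (invmx P *m diag_mx (\row_j (S j)%:R) *m P).

Lemma b_proj (S : pred 'I_d) k : b k *m proj S = (S k)%:R *: b k.
Proof.
by rewrite /proj -lock -row_mul mulmxA mulKVmx // row_mul row_diag_mx -scalemxAl -rowE mxE.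
Qed.

Lemma mx_eq_b m (A B : 'M[F]_(d, m)) : (forall k, b k *m A = b k *m B) -> A = B.
Proof.
move=> E; rewrite -[A](mulKmx Pu) -[B](mulKmx Pu); congr (_ *m _).
by apply/row_matrixP => k; rewrite !row_mul E.
Qed.

Lemma trace_proj_ad (S : pred 'I_d) h : (h <= H)%MS ->
  \tr (proj S *m ad h) = \sum_(k | S k) weval (w k) h.
Proof.
move=> hH; have E : P *m ad h = diag_mx (\row_j weval (w j) h) *m P.
  apply/row_matrixP => k; rewrite !row_mul adE Pw // row_diag_mx.
  by rewrite -scalemxAl -rowE mxE.
rewrite /proj -lock -mulmxA -mulmxA E mxtrace_mulC -!mulmxA mulmxV // mulmx1.
rewrite mulmx_diag mxtrace_diag [RHS]big_mkcond; apply: eq_bigr => k _.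
by rewrite !mxE; case: (S k); rewrite ?mul1r ?mul0r.
Qed.

Lemma trace_ad_ad h h' : (h <= H)%MS -> (h' <= H)%MS ->
  kil h h' = \sum_k weval (w k) h * weval (w k) h'.
Proof.
move=> hH hH'; have E g : (g <= H)%MS -> P *m ad g = diag_mx (\row_j weval (w j) g) *m P.
  move=> gH; apply/row_matrixP => k; rewrite !row_mul adE Pw // row_diag_mx.
  by rewrite -scalemxAl -rowE mxE.
have -> : kil h h' = \tr (P *m ad h *m ad h' *m invmx P).
  by rewrite mxtrace_mulC !mulmxA mulVmx // mul1mx.
rewrite (E h) // -(mulmxA (diag_mx _)) E // mulmxA mulmxK // mulmx_diag mxtrace_diag.
by apply: eq_bigr => k _; rewrite !mxE.
Qed.

(** [x] and [y] preserve the span of the [b k] with [S k], so their commutator has trace 0 there;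
    since [br x y] is in [H], this trace is a sum of weights. *)
Lemma trace_commutator (S : pred 'I_d) x y : (br x y <= H)%MS ->
  (forall k, S k -> b k *m ad x *m proj S = b k *m ad x) ->
  (forall k, S k -> b k *m ad y *m proj S = b k *m ad y) ->
  \sum_(k | S k) weval (w k) (br x y) = 0.
Proof.
move=> xyH sx sy; rewrite -trace_proj_ad // (rep_br ad_rep) mulmxBr linearB /=.
have st z : (forall k, S k -> b k *m ad z *m proj S = b k *m ad z) ->
    proj S *m ad z *m proj S = proj S *m ad z.
  move=> sz; apply: mx_eq_b => k; rewrite !mulmxA b_proj; case: (boolP (S k)) => Sk.
    by rewrite scale1r sz.
  by rewrite scale0r !mul0mx.
have tr z z' : proj S *m ad z *m proj S = proj S *m ad z ->
    \tr (proj S *m (ad z *m ad z')) = \tr (proj S *m ad z *m (proj S *m ad z')).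
  by move=> E; rewrite !mulmxA E.
by rewrite (tr y x) ?(tr x y) ?st // mxtrace_mulC subrr.
Qed.

Lemma proj_wspace (S : pred 'I_d) nu x : (forall k, weq H (w k) nu -> S k) ->
  (x <= wspace ad H nu)%MS -> x *m proj S = x.
Proof.
move=> HS xnu; have [c Ex] := unitmx_rowP Pu x.
rewrite {1 2}Ex mulmx_suml; apply: eq_bigr => k _; rewrite -scalemxAl b_proj.
have [->|ck] := eqVneq (c k) 0; first by rewrite !scale0r.
by rewrite HS ?scale1r //; apply: coord_wspace Ex xnu k ck.
Qed.

Lemma proj_wspace0 (S : pred 'I_d) nu x : (forall k, weq H (w k) nu -> S k = false) ->
  (x <= wspace ad H nu)%MS -> x *m proj S = 0.
Proof.
move=> HS xnu; have [c Ex] := unitmx_rowP Pu x.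
rewrite {1}Ex mulmx_suml big1 // => k _; rewrite -scalemxAl b_proj.
have [->|ck] := eqVneq (c k) 0; first by rewrite !scale0r.
by rewrite HS ?scale0r ?scaler0 //; apply: coord_wspace Ex xnu k ck.
Qed.

Lemma weq_sym nu nu' : weq H nu nu' -> weq H nu' nu.
Proof. by move=> E x /E. Qed.

Lemma weq_trans nu2 nu1 nu3 : weq H nu1 nu2 -> weq H nu2 nu3 -> weq H nu1 nu3.
Proof. by move=> E E' x xH; rewrite E // E'. Qed.

(** * The Cartan subalgebra is its own centralizer *)

Definition cent x := forall h, (h <= H)%MS -> br h x = 0.

Lemma cent_comm x h : cent x -> (h <= H)%MS -> comm_mx (ad x) (ad h).
Proof.
by move=> cx /cx E; apply/eqP; rewrite -subr_eq0 -(rep_br ad_rep) E (rep0 ad_rep).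
Qed.

(** The semisimple part of [ad x] is a derivation, hence some [ad s], and it commutes with [ad h]
    for [h] in [H] because [ad x] does. *)
Lemma cent_jordan x : cent x ->
  exists s, [/\ (s <= H)%MS, cent (x - s) & ad (x - s) ^+ d = 0].
Proof.
move=> cx; have [S [dS nS cS]] := jordan_decomposition (ad x).
have cSx : comm_mx (ad x) S by apply: comm_mx_sym; apply: cS.
have [s Es] := derivation_inner (jordan_derivation dS nS cSx).
have cents : cent s.
  move=> h hH; apply: ad_inj; rewrite (rep0 ad_rep) (rep_br ad_rep) -Es.
  by apply/eqP; rewrite subr_eq0; apply/eqP/cS/cent_comm.
exists s; split; last 1 first.
- by rewrite (repB ad_rep) -Es.
(* [s] commutes with [H] and is ad-diagonalizable, so [H] with [s] adjoined is still toral;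
   maximality gives [s] in [H]. *)
- case: HH => _ /(_ (H + <<s>>)%MS) maxH.
  suff /maxH : toral br (H + <<s>>)%MS.
    move=> /(_ (addsmxSl _ _)); apply: submx_trans.
    by apply: submx_trans (addsmxSr _ _); rewrite genmxE.
  have dec y : (y <= H + <<s>>)%MS -> exists h a, (h <= H)%MS /\ y = h + a *: s.
    case/sub_addsmxP=> -[u1 u2] /= ->.
    have /sub_rVP[a ->] : (u2 *m <<s>>%MS <= s)%MS by rewrite -(genmxE s) submxMl.
    by exists (u1 *m H), a; rewrite submxMl.
  split=> [y z /dec[h [a [hH ->]]] /dec[h' [a' [hH' ->]]]|y /dec[h [a [hH ->]]]].
    rewrite !brDl !brDr !brZr !brZl brxx H_abelian // (cents h) //.
    by rewrite [br s h']br_anti (cents h') // oppr0 !scaler0 !addr0 sub0mx.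
  rewrite addrC ad_lin addrC -Es; apply: diagonalizable_add.
  - rewrite /comm_mx -scalemxAr -scalemxAl Es; congr (_ *: _).
    by apply/comm_mx_sym/cent_comm.
  - exact: H_diag.
  - exact: diagonalizable_scale.
- have sH : cent s := cents.
  by move=> h hH; rewrite brDr cx // -scaleN1r brZr cents // scaler0 addr0.
Qed.

(** The projector to the weight space of [w k] commutes with [ad n], so the product is nilpotent. *)
Lemma cent_nilp_trace k n : cent n -> ad n ^+ d = 0 ->
  \tr (proj (fun j => weqb (w j) (w k)) *m ad n) = 0.
Proof.
move=> cn nn; set Q := proj _.
have cQ : comm_mx Q (ad n).
  apply: mx_eq_b => j; rewrite !mulmxA b_proj.
  have bn : (b j *m ad n <= wspace ad H (w j))%MS.
    apply/(wspaceP ad_rep) => h hH; rewrite -mulmxA (cent_comm cn hH) mulmxA.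
    by rewrite [b j *m ad h]adE Pw // -scalemxAl.
  case: (boolP (weqb _ _)) => /weqP jk.
    rewrite scale1r (proj_wspace _ bn) // => i ij; apply/weqP.
    exact: weq_trans ij jk.
  rewrite scale0r mul0mx (proj_wspace0 _ bn) // => i ij.
  by apply/weqP => ik; apply: jk; apply: weq_trans ik; apply: weq_sym.
apply: (@mxtrace_nilpotent _ _ _ d).
by rewrite -[_ *m _]/(_ * _) exprMn_comm ?nn ?mulr0.
Qed.

(* The ad-nilpotent elements of the centralizer of H are closed under addition:
   the semisimple part s of n + n' has trace 0 on every root space, so it is 0. *)
Lemma cent_nilp_add n n' : cent n -> ad n ^+ d = 0 -> cent n' -> ad n' ^+ d = 0 ->
  ad (n + n') ^+ d = 0.
Proof.
move=> cn nn cn' nn'.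
have cnn : cent (n + n') by move=> h hH; rewrite brDr cn // cn' // addr0.
have [s [sH cs ns]] := cent_jordan cnn.
suff s0 : s = 0 by rewrite s0 subr0 in ns.
suff ws k : weval (w k) s = 0.
  apply: ad_inj; rewrite (rep0 ad_rep); apply: mx_eq_b => k.
  by rewrite adE Pw // ws scale0r mulmx0.
have := cent_nilp_trace k cs ns; rewrite (repB ad_rep) (repD ad_rep).
rewrite mulmxBr mulmxDr linearB linearD /=
  (cent_nilp_trace k cn nn) (cent_nilp_trace k cn' nn') addr0 sub0r.
move/eqP; rewrite oppr_eq0 trace_proj_ad //.
rewrite (eq_bigr (fun=> weval (w k) s)); last first.
  by move=> j /weqP ->.
rewrite sumr_const -mulr_natr mulf_eq0 => /orP[/eqP //|].
rewrite natF_eq0 => /eqP/card0_eq/(_ k).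
by rewrite unfold_in => /negP; case; apply/weqP.
Qed.

(** Split off the part in [H]. The remainder [n] is ad-nilpotent and must be 0, being
    Killing-orthogonal to [H] (a product of commuting matrices, one of them nilpotent), to the
    nilpotents of the centralizer, and by invariance to every basis vector of nonzero weight. *)
Lemma cent_in_H x : cent x -> (x <= H)%MS.
Proof.
move=> cx; have [s [sH cn nn]] := cent_jordan cx.
suff n0 : x - s = 0 by move/eqP: n0; rewrite subr_eq0 => /eqP ->.
move: (x - s) cn nn => n cn nn {s sH x cx}.
have kn n' : cent n' -> ad n' ^+ d = 0 -> kil n n' = 0.
  move=> cn' nn'; have nnn := cent_nilp_add cn nn cn' nn'.
  have sq (m : 'rV_d) : ad m ^+ d = 0 -> kil m m = 0.
    move=> nm; apply: (@mxtrace_nilpotent _ _ _ d).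
    by rewrite -[_ *m _]/(_ * _) -expr2 exprAC nm expr0n.
  (* Polarization: the squares of [ad n], [ad n'] and [ad (n + n')] have trace 0, so twice
     [kil n n'] is 0. *)
  have := sq _ nnn; rewrite kilDl !kilDr (sq _ nn) (sq _ nn') add0r addr0 (kilC n').
  by rewrite -mulr2n -mulr_natr => /eqP; rewrite mulf_eq0 natF_eq0 orbF => /eqP.
have kh h : (h <= H)%MS -> kil n h = 0.
  move=> hH; apply: (@mxtrace_nilpotent _ _ _ d).
  by rewrite -[_ *m _]/(_ * _) exprMn_comm ?nn ?mul0r //; apply: cent_comm.
have kc y : cent y -> kil n y = 0.
  move=> /cent_jordan[s' [sH' cn' nn']].
  by rewrite -(subrK s' y) kilDr kn // kh // addr0.
have kb k : kil n (b k) = 0.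
  case: (boolP (weqb (w k) 0)) => [/weqP wk|/weqNP[h hH]].
    by apply: kc => h hH; rewrite Pw // wk // weval0l scale0r.
  rewrite weval0l => wk; apply/eqP; rewrite -(mulrI_eq0 _ (lregP wk)); apply/eqP.
  by rewrite -kilZr -Pw // -kil_inv br_anti cn // oppr0 -[0](scale0r 0) kilZl mul0r.
apply: kil_nondeg => y; have [c ->] := unitmx_rowP Pu y.
by rewrite !kil_sumr; apply: eq_bigr => k _; rewrite !kilZr kb -[X in kil X](scale0r 0) kilZl mul0r.
Qed.

(** * Root spaces and the Killing form *)

Lemma br_wspace nu nu' x y : (x <= wspace ad H nu)%MS -> (y <= wspace ad H nu')%MS ->
  (br x y <= wspace ad H (nu + nu'))%MS.
Proof.
move=> /ad_wspaceP xn /ad_wspaceP yn; apply/ad_wspaceP => h hH.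
by rewrite br_jacobi (xn h) // (yn h) // brZl brZr -scalerDl wevalDl.
Qed.

Lemma wspace0_H x : (x <= wspace ad H 0)%MS -> (x <= H)%MS.
Proof.
by move/ad_wspaceP => E; apply: cent_in_H => h /E ->; rewrite weval0l scale0r.
Qed.

Lemma H_wspace0 x : (x <= H)%MS -> (x <= wspace ad H 0)%MS.
Proof.
by move=> xH; apply/ad_wspaceP => h hH; rewrite H_abelian // weval0l scale0r.
Qed.

Lemma kil_wspace nu nu' x y : (x <= wspace ad H nu)%MS -> (y <= wspace ad H nu')%MS ->
  ~ weq H (nu + nu') 0 -> kil x y = 0.
Proof.
move=> /ad_wspaceP xn /ad_wspaceP yn /weqP/weqNP[h hH].
rewrite weval0l wevalDl => nz; apply/eqP; rewrite -(mulrI_eq0 _ (lregP nz)) mulrDl.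
rewrite -kilZl -kilZr -xn // -yn // br_anti -scaleN1r kilZl mulN1r kil_inv addrC.
by rewrite subrr.
Qed.

(** Vectors of nonzero weight are orthogonal to [H] and those of weight zero lie in [H], so testing
    on [H] is testing on the whole algebra. *)
Lemma kilH_nondeg h h' : (h <= H)%MS -> (h' <= H)%MS ->
  (forall g, (g <= H)%MS -> kil h g = kil h' g) -> h = h'.
Proof.
move=> hH hH' E; apply: kil_nondeg => y; have [c ->] := unitmx_rowP Pu y.
rewrite !kil_sumr; apply: eq_bigr => k _; rewrite !kilZr; congr (_ * _).
case: (classic (weq H (w k) 0)) => wk.
  by apply: E; apply: wspace0_H; rewrite -(wspace_weq ad wk) b_wspace.
by rewrite !(kil_wspace (nu := 0) _ (b_wspace k)) ?add0r ?H_wspace0.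
Qed.

Lemma br_opp_wspace nu x y : (x <= wspace ad H nu)%MS ->
  (y <= wspace ad H (- nu))%MS ->
  (br x y <= H)%MS /\ forall h, (h <= H)%MS -> kil (br x y) h = weval nu h * kil x y.
Proof.
move=> xn yn; split; first by apply: wspace0_H; rewrite -(subrr nu) br_wspace.
move=> h hH; move/ad_wspaceP: yn => yn; rewrite kil_inv br_anti yn //.
by rewrite wevalNl scaleNr opprK kilZr.
Qed.

Lemma dual_basis_exists : exists b' : 'I_d -> 'rV[F]_d,
  forall j k, kil (b j) (b' k) = (j == k)%:R.
Proof.
suff /fin_all_exists[b' E] k : exists b', forall j, kil (b j) b' = (j == k)%:R.
  by exists b' => j k; apply: E.
have [nu Hnu] : exists nu, forall x, weval nu x = (x *m invmx P) 0 k.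
  by apply: functional_weval => a x y; rewrite mulmxDl -scalemxAl !mxE.
have [s Es] := kil_repr nu; exists s => j.
by rewrite kilC Es Hnu -row_mul mulmxV // !mxE.
Qed.

(** * Simple roots and positive combinations *)

Variables (r : nat) (alpha : 'I_r -> 'rV[F]_d) (Hbase : is_base br H alpha).
Variables (t : 'I_r -> 'rV[F]_d) (Ht : forall j, killing_dual br H (alpha j) (t j)).

Definition natcomb (m : 'I_r -> nat) := wcomb alpha (fun i => (m i)%:R).

(** The order on weights: [sigma > tau] is [poscomb (sigma - tau)], and the nonzero coefficient
    makes it strict. *)
Definition poscomb nu := exists2 m : 'I_r -> nat, exists i, m i != 0%N & weq H nu (natcomb m).

Lemma weval_wcomb c x : weval (wcomb alpha c) x = \sum_i c i * weval (alpha i) x.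
Proof. by rewrite weval_suml; apply: eq_bigr => i _; rewrite wevalZl. Qed.

(** The fundamental coweights. Simple roots are independent as functionals on [H], so the matrix of
    their values on the rows of [H] has a right inverse. Pairing with [g j] reads off the
    coefficient of [alpha j]. *)
Lemma dual_simple_roots : exists g : 'I_r -> 'rV[F]_d,
  (forall j, (g j <= H)%MS) /\ forall i j, weval (alpha i) (g j) = (i == j)%:R.
Proof.
pose A := \matrix_(i < r, l < d) weval (alpha i) (row l H).
have fA : row_free A.
  rewrite -kermx_eq0; apply/eqP/row_matrixP => i; rewrite row0; set c := row i _.
  have cA : c *m A = 0 by rewrite -row_mul mulmx_ker row0.
  apply/rowP => j; rewrite [RHS]mxE; case: Hbase => _ /(_ (c 0)) -> //.
  move=> x /submxP[z ->]; rewrite weval0l mulmx_sum_row weval_sumr big1 // => l _.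
  rewrite wevalZr weval_wcomb.
  have /rowP/(_ l) := cA; rewrite [RHS]mxE mxE => El.
  rewrite (_ : \sum_k _ = 0) ?mulr0 // -[RHS]El.
  by apply: eq_bigr => k _; rewrite [A _ _]mxE.
exists (fun j => \sum_l pinvmx A l j *: row l H); split=> [j|i j].
  by apply: summx_sub => l _; apply: scalemx_sub; apply: row_sub.
rewrite weval_sumr; have /matrixP/(_ i j) := mulmxVp fA; rewrite !mxE => <-.
by apply: eq_bigr => l _; rewrite wevalZr mulrC ?mxE.
Qed.

Variables (g : 'I_r -> 'rV[F]_d) (gH : forall j, (g j <= H)%MS).
Hypothesis Hg : forall i j, weval (alpha i) (g j) = (i == j)%:R.

Lemma weval_natcomb_g m j : weval (natcomb m) (g j) = (m j)%:R.
Proof.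
rewrite weval_wcomb (bigD1 j) //= Hg eqxx mulr1 big1 ?addr0 // => i /negPf ij.
by rewrite Hg ij mulr0.
Qed.

Lemma natF_inj m m' : m%:R = m'%:R :> F -> m = m'.
Proof.
wlog le : m m' / (m <= m')%N.
  by move=> W; case/orP: (leq_total m m') => le E; [|apply/esym]; apply: W.
move=> E; apply/eqP; rewrite eqn_leq le -subn_eq0 -natF_eq0.
by rewrite natrB // E subrr eqxx.
Qed.

Lemma poscomb_add nu nu' : poscomb nu -> poscomb nu' -> poscomb (nu + nu').
Proof.
move=> [m [i mi] E] [m' _ E']; exists (fun j => m j + m' j)%N.
  by exists i; rewrite addn_eq0 negb_and mi.
move=> x xH; rewrite wevalDl E // E' // !weval_wcomb -big_split /=.
by apply: eq_bigr => j _; rewrite natrD mulrDl.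
Qed.

Lemma poscomb_weq nu nu' : weq H nu nu' -> poscomb nu -> poscomb nu'.
Proof. by move=> E [m i0 E']; exists m => // x xH; rewrite -E // E'. Qed.

Lemma poscomb_n0 nu : weq H nu 0 -> ~ poscomb nu.
Proof.
move=> E [m [i mi] E']; have := E' _ (gH i).
by rewrite E // weval0l weval_natcomb_g => /esym/eqP; apply/negP; rewrite natF_neq0.
Qed.

Lemma poscombN nu : poscomb nu -> ~ poscomb (- nu).
Proof.
move=> p /(poscomb_add p); apply: poscomb_n0 => x _.
by rewrite subrr.
Qed.

Lemma poscomb_simple i : poscomb (alpha i).
Proof.
exists (fun j => j == i : nat); first by exists i; rewrite eqxx.
move=> x _; rewrite weval_wcomb (bigD1 i) //= eqxx mul1r big1 ?addr0 // => j /negPf->.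
by rewrite mul0r.
Qed.

Lemma b_root k : ~ weq H (w k) 0 -> is_root br H (w k).
Proof.
split=> //; apply/eqP => E; have := b_wspace k; rewrite E submx0.
by rewrite (negPf (b_neq0 k)).
Qed.

Lemma weight_trichotomy k : [\/ poscomb (w k), weq H (w k) 0 | poscomb (- w k)].
Proof.
case: (classic (weq H (w k) 0)) => wk; first by constructor 2.
have nz (m : 'I_r -> nat) nu : weq H nu (natcomb m) -> ~ weq H nu 0 -> exists i, m i != 0%N.
  move=> E n0; apply: NNPP => N; apply: n0 => x xH; rewrite E // weval0l weval_wcomb.
  rewrite big1 // => i _; case: (eqVneq (m i) 0%N) => [->|mi]; first by rewrite mul0r.
  by case: N; exists i.
case: Hbase => _ _ /(_ _ (b_root wk))[m [E|E]].
  by constructor 1; exists m => //; apply: nz E wk.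
have E' : weq H (- w k) (natcomb m) by move=> x xH; rewrite wevalNl E // wevalNl opprK.
constructor 3; exists m => //; apply: nz E' _ => N; apply: wk => x xH.
by have := N x xH; rewrite wevalNl weval0l => /eqP; rewrite oppr_eq0 => /eqP.
Qed.

Lemma simple_weight i : exists k, weq H (w k) (alpha i).
Proof.
have [/(_ i)[_ /rowV0Pn[x xa x0]] _ _] := Hbase.
have [c Ex] := unitmx_rowP Pu x; apply: NNPP => N; case/eqP: x0.
rewrite Ex big1 // => k _; have [->|ck] := eqVneq (c k) 0; first by rewrite scale0r.
by case: N; exists k; apply: coord_wspace Ex xa k ck.
Qed.

Lemma tH i : (t i <= H)%MS. Proof. by case: (Ht i). Qed.
Lemma kil_t i h : (h <= H)%MS -> kil (t i) h = weval (alpha i) h.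
Proof. by case: (Ht i) => _; apply. Qed.

Variables (b' : 'I_d -> 'rV[F]_d) (Hb' : forall j k, kil (b j) (b' k) = (j == k)%:R).

Lemma expand_b x : x = \sum_k kil x (b' k) *: b k.
Proof.
have [c {1 2}->] := unitmx_rowP Pu x; apply: eq_bigr => k _; congr (_ *: _).
rewrite kil_suml (bigD1 k) //= kilZl Hb' eqxx mulr1 big1 ?addr0 // => j /negPf jk.
by rewrite kilZl Hb' jk mulr0.
Qed.

Lemma kil_b_nondeg x y : (forall k, kil (b k) x = kil (b k) y) -> x = y.
Proof.
move=> E; apply: kil_nondeg => z; rewrite !(kilC _ z); have [c ->] := unitmx_rowP Pu z.
by rewrite !kil_suml; apply: eq_bigr => k _; rewrite !kilZl E.
Qed.

Lemma b'_wspace k : (b' k <= wspace ad H (- w k))%MS.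
Proof.
apply/ad_wspaceP => h hH; apply: kil_b_nondeg => j.
rewrite -kil_inv br_anti Pw // -scaleNr kilZl kilZr Hb' wevalNl.
by case: eqP => [->|_]; rewrite ?mulr0.
Qed.

Lemma br_b_b' k : (br (b k) (b' k) <= H)%MS /\
  forall h, (h <= H)%MS -> kil (br (b k) (b' k)) h = weval (w k) h.
Proof.
have [HT kT] := br_opp_wspace (b_wspace k) (b'_wspace k); split=> // h hH.
by rewrite kT // Hb' eqxx mulr1.
Qed.

(** Killing-dual bases supply the triple: [br (b k) (b' k)] represents [w k] on [H], as [t i]
    represents [alpha i]. *)
Lemma simple_triple i : exists e f, [/\ (e <= wspace ad H (alpha i))%MS,
  (f <= wspace ad H (- alpha i))%MS & br e f = t i].
Proof.
have [k Ek] := simple_weight i; exists (b k), (b' k).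
have En : weq H (- w k) (- alpha i) by move=> x xH; rewrite !wevalNl Ek.
rewrite -(wspace_weq ad Ek) -(wspace_weq ad En) b_wspace b'_wspace; split=> //.
have [TH kT] := br_b_b' k; apply: kilH_nondeg => // [|h hH]; first exact: tH.
by rewrite kT // kil_t // Ek.
Qed.

(** If [(alpha i, alpha i)] were 0, [e] and [f] would preserve the sum of the weight spaces whose
    weight has a given value at [t i]. The trace of [t i] there, that value times the dimension,
    would be 0; so every weight would vanish at [t i], and [t i] would be 0. *)
Lemma alpha_t_neq0 i : weval (alpha i) (t i) != 0.
Proof.
apply/eqP => a0; have [e [f [we wf ef]]] := simple_triple i.
suff wt k : weval (w k) (t i) = 0.
  have t0 : t i = 0.
    apply: ad_inj; rewrite (rep0 ad_rep); apply: mx_eq_b => k.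
    by rewrite adE Pw ?tH // wt scale0r mulmx0.
  have [/(_ i)[n0 _] _ _] := Hbase; apply: n0 => h hH.
  by rewrite weval0l -kil_t // t0 -[0 in LHS](scale0r 0) kilZl mul0r.
pose S : pred 'I_d := fun j => weval (w j) (t i) == weval (w k) (t i).
have : \sum_(j | S j) weval (w j) (br e f) = 0.
  apply: trace_commutator => [|j /eqP Sj|j /eqP Sj]; first by rewrite ef tH.
    rewrite adE; apply: (proj_wspace _ (br_wspace we (b_wspace j))) => l El.
    by rewrite /S El ?tH // wevalDl a0 add0r Sj.
  rewrite adE; apply: (proj_wspace _ (br_wspace wf (b_wspace j))) => l El.
  by rewrite /S El ?tH // wevalDl wevalNl a0 oppr0 add0r Sj.
rewrite ef (eq_bigr (fun=> weval (w k) (t i))); last by move=> j /eqP.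
rewrite sumr_const -mulr_natr => /eqP; rewrite mulf_eq0 => /orP[/eqP //|].
rewrite natF_eq0 => /eqP/card0_eq/(_ k).
by rewrite (_ : k \in S) //; apply: eqxx.
Qed.

(** * Action of sl2 triples and integrality of weights *)

Lemma iterate_exit n (A B N : 'M[F]_n) (v : 'rV[F]_n) (c s : F) : s != 0 ->
  (forall k, v *m A ^+ k *m B = (c + s *+ k) *: (v *m A ^+ k)) ->
  ~~ (v <= N)%MS ->
  exists j, ~~ (v *m A ^+ j <= N)%MS /\ (v *m A ^+ j.+1 <= N)%MS.
Proof.
move=> s0 HB vN.
have [j0 Hj0] : exists j, (v *m A ^+ j <= N)%MS.
  (* Otherwise the iterates of index 0 to [n] are nonzero eigenvectors of [B] with [n.+1] distinct
     eigenvalues. *)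
  apply: NNPP => H0; suff : (size [seq (c + s *+ k)%R | k <- iota 0 n.+1] <= n)%N.
    by rewrite size_map size_iota ltnn.
  apply: (@uniq_eigenvalues_size _ _ B).
    rewrite map_inj_uniq ?iota_uniq // => k k' /addrI.
    rewrite -![s *+ _]mulr_natl => E; apply: natF_inj.
    exact: (mulIf s0).
  move=> _ /mapP[k _ ->]; exists (v *m A ^+ k); first exact: HB.
  by apply/eqP => E; apply: H0; exists k; rewrite E sub0mx.
have ex : exists j, (v *m A ^+ j <= N)%MS by exists j0.
have := ex_minnP ex; case=> -[|j] Hj min.
  by move: Hj; rewrite expr0 mulmx1 (negPf vN).
exists j; split=> //; apply/negP => /min; by rewrite ltnn.
Qed.

Lemma mulmx_expSr n (v : 'rV[F]_n) A k : v *m A ^+ k.+1 = v *m A ^+ k *m A.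
Proof. by rewrite exprSr -[_ * _]/(_ *m _) mulmxA. Qed.

(** [v] is a highest weight vector modulo [N] for the sl2 triple [E], [X], [Y], so modulo [N] the
    vector [v *m Y ^+ k.+1 *m E] is [(k + 1) (c - k)] times [v *m Y ^+ k]. At the last iterate
    outside [N] it lies in [N], which forces [c = k]. *)
Lemma sl2_nat n (E Y X N : 'M[F]_n) (v : 'rV[F]_n) c :
  Y *m E = E *m Y + X -> Y *m X = X *m Y - 2%:R *: Y ->
  stablemx N E -> stablemx N Y -> v *m X = c *: v -> (v *m E <= N)%MS -> ~~ (v <= N)%MS -> is_nat c.
Proof.
move=> YE YX sE sY vX vE vN.
have s0 : - 2%:R != 0 :> F by rewrite oppr_eq0 natF_neq0.
have eig k : v *m Y ^+ k *m X = (c + (- 2%:R) *+ k) *: (v *m Y ^+ k).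
  elim: k => [|k IH]; first by rewrite expr0 mulmx1 mulr0n addr0.
  rewrite mulmx_expSr -mulmxA YX mulmxBr mulmxA IH -scalemxAl -scalemxAr -scalerBl.
  by rewrite [_ *+ k.+1]mulrSr addrA.
have [j [nj yj]] := iterate_exit s0 eig vN.
exists j; have main k : (v *m Y ^+ k.+1 *m E - (k.+1%:R * (c - k%:R)) *: (v *m Y ^+ k) <= N)%MS.
  elim: k => [|k IH].
    rewrite expr1 expr0 -mulmxA YE mulmxDr !mulmxA vX mulmx1 mul1r subr0 addrK.
    exact: submx_trans (submxMr _ vE) sY.
  rewrite mulmx_expSr -mulmxA YE mulmxDr eig mulmxA.
  have -> : v *m Y ^+ k.+1 *m E *m Y + (c + (- 2%:R) *+ k.+1) *: (v *m Y ^+ k.+1) -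
      (k.+2%:R * (c - k.+1%:R)) *: (v *m Y ^+ k.+1) =
      (v *m Y ^+ k.+1 *m E - (k.+1%:R * (c - k%:R)) *: (v *m Y ^+ k)) *m Y.
    rewrite mulmxBl -scalemxAl -mulmx_expSr -addrA -scalerBl -scaleNr.
    by congr (_ + _ *: _); rewrite -mulr_natl -[k.+2%:R]natr1 -!natr1; ring.
  exact: submx_trans (submxMr _ IH) sY.
have zE := submx_trans (submxMr E yj) sE.
have : ((j.+1%:R * (c - j%:R)) *: (v *m Y ^+ j) <= N)%MS.
  by rewrite -[X in (X <= _)%MS](subKr (v *m Y ^+ j.+1 *m E)) addmx_sub ?eqmx_opp.
apply: contraTeq => cj; rewrite eqmx_scale // mulf_neq0 ?subr_eq0 //.
by rewrite natF_neq0.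
Qed.

(** [h] is the coroot: scaling [f] by [2 / (alpha i, alpha i)] turns [t i] into the element at which
    weights take their coefficients. *)
Lemma sl2_triple i : exists e f h, [/\ (e <= wspace ad H (alpha i))%MS, br e f = h,
  br h e = 2%:R *: e, br h f = - (2%:R *: f) &
  (h <= H)%MS /\ forall nu, weval nu h = wcoord alpha t nu i].
Proof.
have [e [f [we wf ef]]] := simple_triple i; have a0 := alpha_t_neq0 i.
set a := weval (alpha i) (t i) in a0.
exists e, ((2%:R / a) *: f), ((2%:R / a) *: t i).
have /ad_wspaceP/(_ _ (tH i)) te := we; have /ad_wspaceP/(_ _ (tH i)) tf := wf.
split=> //; first by rewrite brZr ef.
- by rewrite brZl te scalerA divfK.
- by rewrite brZl brZr tf wevalNl scaleNr !scalerN !scalerA mulrAC divfK.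
- split=> [|nu]; first by rewrite scalemx_sub ?tH.
  by rewrite wevalZr /wcoord -/a mulrAC.
Qed.

Section Module.
Variables (n : nat) (rho : 'rV[F]_d -> 'M[F]_n) (Hrho : is_rep br rho).
Implicit Types (tau : 'rV[F]_d) (v : 'rV[F]_n).

Lemma rep_comm x y : rho x *m rho y = rho y *m rho x - rho (br x y).
Proof. by rewrite (rep_br Hrho) opprB addrC subrK. Qed.

Lemma wcoord_nat (N : 'M[F]_n) tau v i : Defs.invariant rho N ->
  (v <= wspace rho H tau)%MS ->
  (forall e, (e <= wspace ad H (alpha i))%MS -> (v *m rho e <= N)%MS) ->
  ~~ (v <= N)%MS -> is_nat (wcoord alpha t tau i).
Proof.
move=> iN vt ve vN; have [e [f [h [we ef he hf [hH <-]]]]] := sl2_triple i.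
apply: (@sl2_nat _ (rho e) (rho f) (rho h) N v) => //.
- by rewrite rep_comm br_anti (repN Hrho) opprK ef.
- rewrite rep_comm br_anti hf opprK (repZ Hrho) //.
- by have /(wspaceP Hrho)-> := vt.
- exact: ve.
Qed.

(** The last nonzero iterate of [rho e] on [v], of index [j], is a highest weight vector for the
    triple; its eigenvalue, the coefficient of [tau] plus [2 j], is a natural number. *)
Lemma wcoord_int tau v i : (v <= wspace rho H tau)%MS -> v != 0 ->
  exists z : int, wcoord alpha t tau i = z%:~R.
Proof.
move=> vt v0; have [e [f [h [we ef he hf [hH <-]]]]] := sl2_triple i.
have s0 : 2%:R != 0 :> F by rewrite natF_neq0.
have eig k : v *m rho e ^+ k *m rho h = (weval tau h + 2%:R *+ k) *: (v *m rho e ^+ k).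
  elim: k => [|k IH].
    by rewrite expr0 mulmx1 mulr0n addr0; have /(wspaceP Hrho)-> := vt.
  rewrite mulmx_expSr -mulmxA rep_comm br_anti he (repN Hrho) opprK (repZ Hrho).
  rewrite mulmxDr mulmxA IH -scalemxAl -scalemxAr -scalerDl.
  by rewrite [_ *+ k.+1]mulrSr [in RHS]addrA.
have [|j [nj ej]] := @iterate_exit _ _ _ 0 v _ _ s0 eig; first by rewrite submx0.
have [] := @sl2_nat _ (rho e) (rho f) (rho h) 0 (v *m rho e ^+ j) (weval tau h + 2%:R *+ j).
- by rewrite rep_comm br_anti (repN Hrho) opprK ef.
- rewrite rep_comm br_anti hf opprK (repZ Hrho) //.
- by rewrite mul0mx.
- by rewrite mul0mx.
- exact: eig.
- by rewrite -mulmx_expSr.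
- by [].
move=> m E; exists (m%:Z - 2%:Z *+ j); rewrite rmorphB rmorphMn /=.
by rewrite -pmulrn -E -[(2%:Z)%:~R]pmulrn addrK.
Qed.
End Module.

(** * Positive rationals, and the values [(alpha i, alpha i)] and [(2 rho, alpha i)] *)

Definition posq (x : F) := exists p q : nat, x = p.+1%:R / q.+1%:R.

(** [F] has no order, so [posq] expresses positivity; characteristic zero keeps it away from 0. *)
Lemma posq_neq0 (x : F) : posq x -> x != 0.
Proof. by case=> p [q ->]; rewrite mulf_neq0 ?invr_eq0 ?natF_neq0. Qed.

Lemma posq_nat m : posq m.+1%:R.
Proof. by exists m, 0%N; rewrite divr1. Qed.

Lemma posqM (x y : F) : posq x -> posq y -> posq (x * y).
Proof.
move=> [p [q ->]] [p' [q' ->]]; exists (p.+1 * p'.+1).-1, (q.+1 * q'.+1).-1.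
by rewrite !prednK ?muln_gt0 // !natrM mulf_div.
Qed.

Lemma posqV (x : F) : posq x -> posq x^-1.
Proof. by move=> [p [q ->]]; exists q, p; rewrite invf_div. Qed.

Lemma posqD (x y : F) : posq x -> posq y -> posq (x + y).
Proof.
move=> [p [q ->]] [p' [q' ->]].
exists (p.+1 * q'.+1 + p'.+1 * q.+1).-1, (q.+1 * q'.+1).-1.
rewrite !prednK ?muln_gt0 ?addn_gt0 ?muln_gt0 //.
by rewrite addf_div ?natF_neq0 // natrD !natrM.
Qed.

Lemma posq_sum (I : finType) (A : pred I) (f : I -> F) :
  (forall i, A i -> f i = 0 \/ posq (f i)) -> (exists2 i, A i & posq (f i)) ->
  posq (\sum_(i | A i) f i).
Proof.
move=> Hf [i Ai fi]; rewrite (bigD1 i) //=.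
suff [->|H0] : \sum_(j | A j && (j != i)) f j = 0 \/ posq (\sum_(j | A j && (j != i)) f j).
- by rewrite addr0.
- exact: posqD.
apply: (big_ind (fun x : F => x = 0 \/ posq x)); first by left.
  move=> x y [->|px] [->|py]; rewrite ?addr0 ?add0r; [by left|by right|by right|].
  by right; apply: posqD.
by move=> j /andP[/Hf].
Qed.

(** The roots have integer coefficients, and the sum of the squares of their coefficients at [i], a
    trace, equals [4 (t i, t i) / (alpha i, alpha i)^2 = 4 / (alpha i, alpha i)]. This sum is a
    natural number, and not 0. *)
Lemma alpha_t_posq i : posq (weval (alpha i) (t i)).
Proof.
set a := weval _ _; have a0 : a != 0 := alpha_t_neq0 i.
have Hz k : exists z : int, wcoord alpha t (w k) i = z%:~R.
  exact: (wcoord_int ad_rep _ (b_wspace k) (b_neq0 k)).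
have [z {}Hz] := fin_all_exists Hz.
have kt : kil (t i) (t i) = a by rewrite kil_t ?tH.
have : \sum_k (wcoord alpha t (w k) i) ^+ 2 = 4%:R / a.
  transitivity (\sum_k (4%:R / a ^+ 2) * (weval (w k) (t i) * weval (w k) (t i))).
    by apply: eq_bigr => k _; rewrite /wcoord -/a; field.
  by rewrite -mulr_sumr -trace_ad_ad ?tH // kt expr2 invfM -!mulrA mulVf // mulr1.
have -> : \sum_k (wcoord alpha t (w k) i) ^+ 2 = (\sum_k `|z k| ^ 2)%N%:R.
  rewrite natr_sum; apply: eq_bigr => k _.
  by rewrite Hz -rmorphXn /= -[(`|z k| ^ 2)%N%:R]/((`|z k| ^ 2)%N%:Z%:~R) -abszX abszE ger0_norm ?sqr_ge0.
case: (\sum_k _)%N => [|m] E.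
  by move/esym/eqP: E; rewrite mulf_eq0 invr_eq0 (negPf a0) natF_eq0.
have -> : a = 4%:R / m.+1%:R by rewrite E invf_div mulrC divfK ?natF_neq0.
by exists 3%N, m.
Qed.

Lemma posq_wcoord tau i : is_nat (wcoord alpha t tau i) ->
  weval tau (t i) = 0 \/ posq (weval tau (t i)).
Proof.
move=> [m]; have pa := alpha_t_posq i; have a0 := alpha_t_neq0 i.
rewrite /wcoord => E; have -> : weval tau (t i) = m%:R * (weval (alpha i) (t i) / 2%:R).
  by rewrite -E; field; rewrite a0 natF_neq0.
case: (m) => [|m']; first by left; rewrite mul0r.
by right; apply: posqM; [apply: posq_nat | apply/posqM/posqV/posq_nat].
Qed.

Variables (pos : pred 'I_d) (Hpos : forall k, pos k <-> poscomb (w k)).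

(* ad e_i and ad f_i stabilize the span of the positive root spaces whose root is
   not a multiple of alpha_i, so ad t_i = [ad e_i, ad f_i] has trace 0 there. *)
Lemma sum_pos_posq i : posq (\sum_(k | pos k) weval (w k) (t i)).
Proof.
pose other k := [exists j, (j != i) && (weval (w k) (g j) != 0)].
rewrite (bigID other) /=.
have -> : \sum_(k | pos k && other k) weval (w k) (t i) = 0.
  have [e [f [we wf ef]]] := simple_triple i.
  have st s x k : (forall j, j != i -> weval s (g j) = 0) ->
      (x <= wspace ad H s)%MS -> pos k && other k ->
      b k *m ad x *m proj (fun l => pos l && other l) = b k *m ad x.
    move=> s0 xs /andP[pk /existsP[j /andP[ji kj]]]; rewrite adE.
    apply: (proj_wspace _ (br_wspace xs (b_wspace k))) => l El.
    (* Adding or subtracting [alpha i] leaves the coefficient at [j] unchanged; it is a positive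
       integer, so the new weight is neither 0 nor negative. *)
    have lj : weval (w l) (g j) = weval (w k) (g j).
      by rewrite El // wevalDl s0 // add0r.
    have -> : other l by apply/existsP; exists j; rewrite ji lj.
    rewrite andbT; apply/Hpos; case: (weight_trichotomy l) => // [l0|[m _ E]].
      by move: kj; rewrite -lj l0 // weval0l eqxx.
    have /Hpos[m' _ E'] := pk.
    move: lj kj; rewrite E' // weval_natcomb_g -[LHS]opprK -wevalNl E // weval_natcomb_g.
    move=> /eqP; rewrite eq_sym -addr_eq0 -natrD natF_eq0 addn_eq0 => /andP[/eqP-> _].
    by rewrite eqxx.
  have al j : j != i -> weval (alpha i) (g j) = 0 by move=> ji; rewrite Hg eq_sym (negPf ji).
  rewrite -ef; apply: trace_commutator => [|k pk|k pk]; first by rewrite ef tH.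
    exact: st we pk.
  by apply: st wf pk => j ji; rewrite wevalNl al ?oppr0.
(* What remains are positive multiples of [alpha i], among them [alpha i] itself. *)
rewrite add0r; have mult k : pos k && ~~ other k -> posq (weval (w k) (t i)).
  case/andP=> /Hpos[m [j mj] E]; rewrite negb_exists => /forallP no.
  have m0 l : l != i -> m l = 0%N.
    move=> li; have := no l; rewrite li negbK E // weval_natcomb_g natF_eq0.
    by move/eqP.
  have ji : j = i by apply/eqP/negPn/negP => /m0 mj0; rewrite mj0 in mj.
  rewrite E ?tH // weval_wcomb (bigD1 i) //= big1 ?addr0 => [|l li]; last first.
    by rewrite m0 ?mul0r.
  rewrite -ji; case: (m j) mj => // m' _.
  by apply: posqM (posq_nat _) (alpha_t_posq _).
apply: posq_sum => [k pk|]; first by right; apply: mult.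
have [k Ek] := simple_weight i; have pk : pos k && ~~ other k.
  apply/andP; split; first exact/Hpos/(poscomb_weq (weq_sym Ek))/poscomb_simple.
  rewrite negb_exists; apply/forallP => j; apply/nandP.
  case: (eqVneq j i) => [_|ji]; [by left | right; rewrite negbK].
  by rewrite Ek // Hg [i == j]eq_sym (negPf ji).
by exists k => //; apply: mult.
Qed.

(** * Weight modules and the Casimir element *)

Section WeightModule.
Variables (n : nat) (rho : 'rV[F]_d -> 'M[F]_n) (Hrho : is_rep br rho).
Implicit Types (tau sigma : 'rV[F]_d) (u v : 'rV[F]_n) (U W N : 'M[F]_n).
Notation inv := (Defs.invariant rho).

Definition wmod := exists s : seq 'rV[F]_d, (1%:M <= \sum_(nu <- s) wspace rho H nu)%MS.

Definition Hstable U := forall h, (h <= H)%MS -> stablemx U (rho h).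

Lemma wspace_scal tau v h : (v <= wspace rho H tau)%MS -> (h <= H)%MS ->
  v *m rho h = weval tau h *: v.
Proof. by move/(wspaceP Hrho); apply. Qed.

Lemma wspace_Hstable tau : Hstable (wspace rho H tau).
Proof.
move=> h hH; apply/row_subP => i; rewrite row_mul (wspace_scal (row_sub i _) hH).
by apply/scalemx_sub/row_sub.
Qed.

Lemma rep_wspace tau nu v x : (v <= wspace rho H tau)%MS -> (x <= wspace ad H nu)%MS ->
  (v *m rho x <= wspace rho H (tau + nu))%MS.
Proof.
move=> vt /ad_wspaceP xn; apply/(wspaceP Hrho) => h hH.
rewrite -mulmxA (rep_comm Hrho) br_anti xn // (repN Hrho) opprK (repZ Hrho) mulmxDr.
by rewrite mulmxA (wspace_scal vt hH) -scalemxAl -scalemxAr -scalerDl wevalDl.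
Qed.

Lemma wspace_neq tau sigma v : ~ weq H tau sigma -> (v <= wspace rho H tau)%MS ->
  (v <= wspace rho H sigma)%MS -> v = 0.
Proof.
move=> /weqP/weqNP[h hH ne] vt vs; apply/eqP; move/eqP: (wspace_scal vt hH).
by rewrite (wspace_scal vs hH) -subr_eq0 -scalerBl scaler_eq0 subr_eq0 eq_sym (negPf ne).
Qed.

(* The projector is a product of factors (h - nu(h)) / (tau(h) - nu(h)) with h in H,
   so it preserves every H-stable subspace. *)
Lemma partial_weight_projector (s : seq 'rV[F]_d) tau : exists Q : 'M[F]_n,
  [/\ (forall U, Hstable U -> stablemx U Q),
      (forall v, (v <= wspace rho H tau)%MS -> v *m Q = v) &
      forall nu v, nu \in s -> ~ weq H nu tau -> (v <= wspace rho H nu)%MS -> v *m Q = 0].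
Proof.
elim: s => [|nu s [Q [sQ idQ kQ]]].
  by exists 1%:M; split=> // [U _|v _]; rewrite mulmx1.
case: (classic (weq H nu tau)) => [E|/weqP/weqNP[h hH ne]].
  by exists Q; split=> // nu' v; rewrite inE => /predU1P[-> //|]; apply: kQ.
exists (Q *m ((weval tau h - weval nu h)^-1 *: (rho h - (weval nu h)%:M))).
split=> [U sU|v vt|nu' v].
- apply: stablemxM; first exact: sQ.
  by rewrite -scalemxAr scalemx_sub // mulmxBr mul_mx_scalar addmx_sub ?eqmx_opp ?scalemx_sub ?sU.
- rewrite mulmxA idQ // -scalemxAr mulmxBr mul_mx_scalar (wspace_scal vt) // -scalerBl.
  by rewrite scalerA mulVf ?scale1r // subr_eq0 eq_sym.
- rewrite inE => /predU1P[->|nus] nn vn; rewrite mulmxA; last by rewrite (kQ nu') ?mul0mx.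
  have vQ : (v *m Q <= wspace rho H nu)%MS.
    by apply: submx_trans (submxMr _ vn) _; apply/sQ/wspace_Hstable.
  by rewrite -scalemxAr mulmxBr mul_mx_scalar (wspace_scal vQ) // subrr scaler0.
Qed.

Hypothesis Hw : wmod.

Lemma weight_projector tau : exists Q : 'M[F]_n,
  [/\ (forall U, Hstable U -> stablemx U Q),
      (forall v, (v <= wspace rho H tau)%MS -> v *m Q = v) &
      forall v, (v *m Q <= wspace rho H tau)%MS].
Proof.
have [s Hs] := Hw; have [Q [sQ idQ kQ]] := partial_weight_projector s tau.
exists Q; split=> // v.
have : (v <= \sum_(nu <- s) wspace rho H nu)%MS by apply: submx_trans Hs; apply: submx1.
move: v; apply: sumsmx_seq_ind => [|u v uQ vQ|nu nus v vn].
- by rewrite mul0mx sub0mx.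
- by rewrite mulmxDl addmx_sub.
- case: (classic (weq H nu tau)) => E; last by rewrite (kQ nu) ?sub0mx.
  by rewrite idQ -(wspace_weq rho E).
Qed.

Lemma weight_projector0 Q sigma tau v : (forall U, Hstable U -> stablemx U Q) ->
  (forall v, (v *m Q <= wspace rho H tau)%MS) -> ~ weq H sigma tau ->
  (v <= wspace rho H sigma)%MS -> v *m Q = 0.
Proof.
move=> sQ imQ nn vn; apply: (wspace_neq nn) => //.
by apply: submx_trans (submxMr _ vn) _; apply/sQ/wspace_Hstable.
Qed.

(** The weight projectors preserve [U], so each vector of [U] is a sum of weight vectors lying in
    [U]. *)
Lemma weight_ind U N : Hstable U ->
  (forall tau v, (v <= wspace rho H tau)%MS -> (v <= U)%MS -> (v <= N)%MS) -> (U <= N)%MS.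
Proof.
move=> sU HN; have [s Hs] := Hw; apply/row_subP => i.
have : (row i U <= \sum_(nu <- s) wspace rho H nu)%MS by apply: submx_trans Hs; apply: submx1.
have : (row i U <= U)%MS by apply: row_sub.
elim: s {i Hs} (row i U) => [|nu s IH] u uU; first by rewrite big_nil submx0 => /eqP->; apply: sub0mx.
(* Weights that agree on [H] have the same weight space; such repetitions are dropped, so that the
   projector separates [nu] from the rest of the list. *)
rewrite big_cons; case: (classic (exists2 nu', nu' \in s & weq H nu nu')) => [[nu' ns E]|no].
  rewrite (wspace_weq rho E) => us; apply: IH => //.
  by apply: submx_trans us _; rewrite addsmx_sub submx_refl sumsmx_seq_sup.
case/sub_addsmxP=> -[x1 x2] /= Eu.
have [Q [sQ idQ kQ]] := partial_weight_projector s nu.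
set u1 := x1 *m _ in Eu; set u2 := x2 *m _ in Eu.
have u1n : (u1 <= wspace rho H nu)%MS by apply: submxMl.
have u2s : (u2 <= \sum_(nu <- s) wspace rho H nu)%MS by apply: submxMl.
have u2Q : u2 *m Q = 0.
  move: u2s; move: (u2); apply: sumsmx_seq_ind => [|x y xQ yQ|nu' ns v vn].
  - by rewrite mul0mx.
  - by rewrite mulmxDl xQ yQ addr0.
  - by apply: (kQ nu') => // E; apply: no; exists nu' => //; apply: weq_sym.
have uQ : u *m Q = u1 by rewrite Eu mulmxDl idQ // u2Q addr0.
have u1U : (u1 <= U)%MS by rewrite -uQ; apply: submx_trans (submxMr _ uU) (sQ _ sU).
rewrite Eu; apply: addmx_sub; [exact: (HN nu) | apply: IH => //].
have -> : u2 = u - u1 by rewrite Eu addrC addKr.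
by rewrite addmx_sub ?eqmx_opp.
Qed.

Lemma weight_b_coord nu x N v : (x <= wspace ad H nu)%MS ->
  (forall k, weq H (w k) nu -> (v *m rho (b k) <= N)%MS) -> (v *m rho x <= N)%MS.
Proof.
move=> xn HQ; have [c Ex] := unitmx_rowP Pu x.
rewrite Ex (rep_sum Hrho) mulmx_sumr; apply: summx_sub => k _.
rewrite (repZ Hrho) -scalemxAr.
have [->|ck] := eqVneq (c k) 0; first by rewrite scale0r sub0mx.
by apply/scalemx_sub/HQ; apply: coord_wspace Ex xn k ck.
Qed.

(** * Singular vectors modulo a subspace *)

Definition singular N v := forall nu x, poscomb nu -> (x <= wspace ad H nu)%MS ->
  (v *m rho x <= N)%MS.

Lemma singularP N v : (forall k, pos k -> (v *m rho (b k) <= N)%MS) -> singular N v.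
Proof.
move=> Hv nu x pn xn; apply: (weight_b_coord xn) => k E.
by apply/Hv/Hpos/(poscomb_weq (weq_sym E)).
Qed.

(** A weight vector of [U] outside [N] that is not singular modulo [N] can be raised without
    entering [N]. Each raising adds a positive integer to the eigenvalue of [h0], so the dimension
    [n] bounds the number of raisings. *)
Lemma climb U N : Hstable U -> (forall k, pos k -> stablemx U (rho (b k))) ->
  ~~ (U <= N)%MS -> exists tau v, [/\ (v <= wspace rho H tau)%MS, (v <= U)%MS,
    ~~ (v <= N)%MS & singular N v].
Proof.
move=> sU pU nUN; apply: NNPP => no.
have [tau0 [v0 [v0t v0U v0N]]] : exists tau v,
    [/\ (v <= wspace rho H tau)%MS, (v <= U)%MS & ~~ (v <= N)%MS].
  apply: NNPP => no0; case/negP: nUN; apply: weight_ind => // tau v vt vU.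
  by apply/negPn/negP => vN; apply: no0; exists tau, v.
(* The sum of the fundamental coweights: its value on a positive combination is the sum of the
   coefficients, the height. *)
pose h0 := \sum_j g j; have h0H : (h0 <= H)%MS by apply: summx_sub => j _.
have ht nu : poscomb nu -> exists m, weval nu h0 = m.+1%:R.
  case=> m [i mi] E; exists (\sum_j m j).-1; rewrite prednK; last first.
    by rewrite (bigD1 i) //= addn_gt0 lt0n mi.
  by rewrite weval_sumr natr_sum; apply: eq_bigr => j _; rewrite E // weval_natcomb_g.
have step m : exists s : seq nat, [/\ size s = m, uniq s,
    (forall p, p \in s -> exists2 v : 'rV[F]_n, v *m rho h0 = (weval tau0 h0 + p%:R) *: v & v != 0) &
    exists q tau v, [/\ (v <= wspace rho H tau)%MS, (v <= U)%MS, ~~ (v <= N)%MS,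
      weval tau h0 = weval tau0 h0 + q%:R & forall p, p \in s -> (p < q)%N]].
  elim: m => [|m [s [<- us Hs [q [tau [v [vt vU vN tq lq]]]]]]].
    exists [::]; split=> //; exists 0%N, tau0, v0; split=> //.
    by rewrite addr0.
  exists (q :: s); split=> //=.
  - by rewrite us andbT; apply/negP => /lq; rewrite ltnn.
  - move=> p; rewrite inE => /predU1P[->|/Hs //]; exists v.
      by rewrite (wspace_scal vt) // tq.
    by apply: contraNneq vN => ->; apply: sub0mx.
  have [k [pk vkN]] : exists k, pos k /\ ~~ (v *m rho (b k) <= N)%MS.
    apply: NNPP => nok; apply: no; exists tau, v; split=> //; apply: singularP => k pk.
    by apply/negPn/negP => vkN; apply: nok; exists k.
  have [m' Em'] := ht _ (proj1 (Hpos k) pk).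
  exists (q + m'.+1)%N, (tau + w k), (v *m rho (b k)); split=> //.
  - exact: rep_wspace (b_wspace k).
  - exact: submx_trans (submxMr _ vU) (pU k pk).
  - by rewrite wevalDl tq Em' natrD addrA.
  - move=> p; rewrite inE => /predU1P[->|/lq pq]; first by rewrite -addSnnS leq_addr.
    by apply: leq_trans pq _; apply: leq_addr.
have [s [ss us Hs _]] := step n.+1.
have : (size [seq (weval tau0 h0 + p%:R)%R | p <- s] <= n)%N.
  apply: (@uniq_eigenvalues_size _ _ (rho h0)).
    by rewrite map_inj_uniq // => p q /addrI/natF_inj.
  by move=> _ /mapP[p ps ->]; have [v] := Hs p ps; exists v.
by rewrite size_map ss ltnn.
Qed.

Lemma inv_Hstable U : inv U -> Hstable U.
Proof. by move=> iU h _; apply: iU. Qed.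

Notation dom := (dominant alpha t).

Lemma singular_dom N tau v : inv N -> (v <= wspace rho H tau)%MS -> singular N v ->
  ~~ (v <= N)%MS -> dom tau.
Proof.
move=> iN vt sv vN i; apply: (wcoord_nat Hrho iN vt _ vN) => e we.
by apply: sv we; apply: poscomb_simple.
Qed.

Lemma expand_b' x : x = \sum_k kil x (b k) *: b' k.
Proof.
apply: kil_b_nondeg => j; rewrite kil_sumr (bigD1 j) //= kilZr Hb' eqxx mulr1 kilC.
by rewrite big1 ?addr0 // => k kj; rewrite kilZr Hb' eq_sym (negPf kj) mulr0.
Qed.

(** * The Casimir element and its eigenvalues *)

Definition casimir : 'M[F]_n := \sum_k rho (b' k) *m rho (b k).

(** Expanding [br (b' k) x] in the [b'] and [br (b k) x] in the [b], the coefficients cancel by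
    invariance of the Killing form. *)
Lemma casimir_comm x : casimir *m rho x = rho x *m casimir.
Proof.
apply/eqP; rewrite -subr_eq0 /casimir mulmx_suml mulmx_sumr -sumrB.
have E k : rho (b' k) *m rho (b k) *m rho x - rho x *m (rho (b' k) *m rho (b k)) =
    - (rho (br (b' k) x) *m rho (b k)) - rho (b' k) *m rho (br (b k) x).
  rewrite -mulmxA (rep_comm Hrho (b k) x) mulmxBr [rho (b' k) *m (rho x *m _)]mulmxA.
  rewrite (rep_comm Hrho (b' k) x) mulmxBl -[rho x *m _ *m _]mulmxA.
  by rewrite addrC addrA addrA addNr add0r.
rewrite (eq_bigr _ (fun k _ => E k)) big_split /= !sumrN -opprD oppr_eq0.
have -> : \sum_k rho (br (b' k) x) *m rho (b k) =
    \sum_k \sum_j kil (br (b' k) x) (b j) *: (rho (b' j) *m rho (b k)).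
  apply: eq_bigr => k _; rewrite {1}[br (b' k) x]expand_b' (rep_sum Hrho) mulmx_suml.
  by apply: eq_bigr => j _; rewrite (repZ Hrho) scalemxAl.
have -> : \sum_k rho (b' k) *m rho (br (b k) x) =
    \sum_j \sum_k kil (br (b k) x) (b' j) *: (rho (b' k) *m rho (b j)).
  rewrite exchange_big; apply: eq_bigr => k _ /=.
  rewrite {1}[br (b k) x]expand_b (rep_sum Hrho) mulmx_sumr.
  by apply: eq_bigr => j _; rewrite (repZ Hrho) scalemxAr.
rewrite -big_split big1 // => k _; rewrite -big_split big1 // => j _ /=.
by rewrite -scalerDl kil_inv br_anti -scaleN1r kilZr (kilC (b' k)) mulN1r addNr scale0r.
Qed.

(** This is [(tau, tau + 2 rho)]: the zero-weight parts of the dual bases compute [(tau, tau)], and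
    [br (b k) (b' k)] represents the root [w k], counted with multiplicity in [2 rho]. *)
Definition cas tau : F :=
  \sum_(k | weqb (w k) 0) weval tau (b k) * weval tau (b' k) +
  \sum_(k | pos k) weval tau (br (b k) (b' k)).

Lemma b_H k : weq H (w k) 0 -> (b k <= H)%MS.
Proof. by move=> E; apply: wspace0_H; rewrite -(wspace_weq ad E) b_wspace. Qed.

Lemma b'_H k : weq H (w k) 0 -> (b' k <= H)%MS.
Proof.
move=> E; have En : weq H (- w k) 0.
  by move=> x xH; rewrite wevalNl E // weval0l oppr0.
by apply: wspace0_H; rewrite -(wspace_weq ad En) b'_wspace.
Qed.

(** In each product of nonzero weights the raising operator is made to act on [v] first. For a
    positive root this costs the commutator [br (b k) (b' k)], which lies in [H] and contributes to
    the [2 rho] term. *)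
Lemma casimir_singular N tau v : inv N -> (v <= wspace rho H tau)%MS -> singular N v ->
  (v *m casimir - cas tau *: v <= N)%MS.
Proof.
move=> iN vt sv.
have -> : v *m casimir - cas tau *: v = \sum_k (v *m (rho (b' k) *m rho (b k)) -
   ((if weqb (w k) 0 then weval tau (b k) * weval tau (b' k) else 0) +
    (if pos k then weval tau (br (b k) (b' k)) else 0)) *: v).
  by rewrite mulmx_sumr sumrB -scaler_suml big_split /= -!big_mkcond.
apply: summx_sub => k _; case: (weight_trichotomy k) => [pk|zk|nk].
- have /negPf -> : ~~ weqb (w k) 0 by apply/negP => /weqP/poscomb_n0.
  have /Hpos -> := pk; rewrite add0r (rep_comm Hrho) mulmxBr br_anti (repN Hrho).
  rewrite mulmxN opprK (wspace_scal vt (proj1 (br_b_b' k))) addrK mulmxA.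
  by apply: submx_trans (submxMr _ (sv _ _ pk (b_wspace k))) (iN _).
- have /weqP -> := zk; have /negPf -> : ~~ pos k by apply/negP => /Hpos; apply: poscomb_n0.
  rewrite addr0 mulmxA (wspace_scal vt (b'_H zk)) -scalemxAl (wspace_scal vt (b_H zk)).
  by rewrite scalerA mulrC subrr sub0mx.
- have /negPf -> : ~~ weqb (w k) 0.
    apply/negP => /weqP E; apply: poscomb_n0 nk => x xH.
    by rewrite wevalNl E // weval0l oppr0.
  have /negPf -> : ~~ pos k by apply/negP => /Hpos/poscombN.
  rewrite addr0 scale0r subr0 mulmxA.
  by apply: submx_trans (submxMr _ (sv _ _ nk (b'_wspace k))) (iN _).
Qed.

Lemma sum_zero_b i : \sum_(k | weqb (w k) 0) weval (alpha i) (b' k) *: b k = t i.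
Proof.
rewrite [RHS]expand_b [LHS]big_mkcond; apply: eq_bigr => k _.
case: (boolP (weqb _ _)) => /weqP zk; first by rewrite -kil_t ?b'_H.
rewrite (kil_wspace (nu := 0) _ (b'_wspace k)) ?scale0r ?H_wspace0 ?tH // => E.
by apply: zk => x xH; have := E x xH; rewrite add0r wevalNl weval0l => /eqP; rewrite oppr_eq0 => /eqP.
Qed.

Lemma sum_zero_b' i : \sum_(k | weqb (w k) 0) weval (alpha i) (b k) *: b' k = t i.
Proof.
rewrite [RHS]expand_b' [LHS]big_mkcond; apply: eq_bigr => k _.
case: (boolP (weqb _ _)) => /weqP zk; first by rewrite -kil_t ?b_H.
by rewrite (kil_wspace (nu := 0) _ (b_wspace k)) ?scale0r ?H_wspace0 ?tH // add0r.
Qed.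

(** [(sigma, sigma + 2 rho) - (tau, tau + 2 rho) = (sigma - tau, tau + sigma + 2 rho)], with
    [sigma - tau] expanded in simple roots. *)
Lemma cas_diff sigma tau m : weq H sigma (tau + natcomb m) ->
  cas sigma - cas tau = \sum_i (m i)%:R *
    (weval tau (t i) + weval sigma (t i) + \sum_(k | pos k) weval (w k) (t i)).
Proof.
move=> E; rewrite /cas opprD addrACA -!sumrB.
have Ed x : (x <= H)%MS -> weval sigma x - weval tau x = weval (natcomb m) x.
  by move=> xH; rewrite E // wevalDl addrC addKr.
under [RHS]eq_bigr do rewrite mulrDr.
rewrite [RHS]big_split /=; congr (_ + _).
  transitivity (\sum_(k | weqb (w k) 0) \sum_i (m i)%:R *
      (weval tau (weval (alpha i) (b' k) *: b k) + weval sigma (weval (alpha i) (b k) *: b' k))).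
    apply: eq_bigr => k /weqP zk.
    have -> : weval sigma (b k) * weval sigma (b' k) - weval tau (b k) * weval tau (b' k) =
        weval tau (b k) * weval (natcomb m) (b' k) +
        weval (natcomb m) (b k) * weval sigma (b' k).
      by rewrite -!Ed ?b_H ?b'_H //; ring.
    rewrite !weval_wcomb mulr_sumr mulr_suml -big_split /=; apply: eq_bigr => i _.
    by rewrite !wevalZr; ring.
  rewrite exchange_big; apply: eq_bigr => i _ /=.
  by rewrite -mulr_sumr big_split /= -!weval_sumr sum_zero_b sum_zero_b'.
transitivity (\sum_(k | pos k) \sum_i (m i)%:R * weval (w k) (t i)).
  apply: eq_bigr => k _; have [TH kT] := br_b_b' k; rewrite Ed // weval_wcomb.
  by apply: eq_bigr => i _; rewrite -(kil_t i TH) kilC kT ?tH.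
by rewrite exchange_big; apply: eq_bigr => i _ /=; rewrite mulr_sumr.
Qed.

Lemma cas_neq sigma tau : dom sigma -> dom tau -> poscomb (sigma - tau) ->
  cas sigma != cas tau.
Proof.
move=> ds dt [m [i0 mi0] E]; rewrite -subr_eq0.
have E' : weq H sigma (tau + natcomb m).
  by move=> x xH; rewrite wevalDl -E // wevalDl wevalNl addrC subrK.
rewrite (cas_diff E'); apply: posq_neq0.
have pt i : posq (weval tau (t i) + weval sigma (t i) + \sum_(k | pos k) weval (w k) (t i)).
  have [->|p1] := posq_wcoord (dt i); have [->|p2] := posq_wcoord (ds i);
    rewrite ?add0r ?addr0; do ?apply: posqD => //; exact: sum_pos_posq.
apply: posq_sum => [i _|].
  by case: (m i) => [|k]; [left; rewrite mul0r | right; apply/posqM/pt/posq_nat].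
by exists i0 => //; case: (m i0) mi0 => // k _; apply/posqM/pt/posq_nat.
Qed.

(** * Highest weight modules *)

Lemma cyc_exists tau v : (v <= wspace rho H tau)%MS -> singular 0 v ->
  exists U, [/\ inv U, (v <= U)%MS, (forall W, inv W -> (v <= W)%MS -> (U <= W)%MS) &
    forall sigma u, (u <= wspace rho H sigma)%MS -> (u <= U)%MS ->
      [\/ weq H sigma tau /\ (u <= v)%MS, poscomb (tau - sigma) | u = 0]].
Proof.
move=> vt sv; pose C (A : 'M[F]_n) := exists2 k, poscomb (- w k) & A = rho (b k).
have [U [vU sU mU]] := exists_closure v C.
have iU : inv U.
  (* [T] collects the vectors of [U] that the whole algebra keeps in [U]. It contains [v] by
     singularity, and commuting [x] past a lowering operator shows that it is stable under lowering;
     minimality of [U] gives [U <= T]. *)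
  pose D (u : 'rV[F]_n) := (u <= U)%MS /\ forall x, (u *m rho x <= U)%MS.
  have [||T HT] := @exists_subspace F n D.
  - by split=> [|x]; rewrite ?mul0mx sub0mx.
  - move=> a y z [yU yx] [zU zx]; split=> [|x]; first by rewrite addmx_sub ?scalemx_sub.
    by rewrite mulmxDl -scalemxAl addmx_sub ?scalemx_sub.
  suff UT : (U <= T)%MS.
    move=> x; apply/row_subP => i; rewrite row_mul.
    by have /HT[_] := submx_trans (row_sub i U) UT; apply.
  apply: mU => [|A [k nk ->]].
    apply/HT; split=> // x; rewrite [x]expand_b (rep_sum Hrho) mulmx_sumr.
    apply: summx_sub => k _; rewrite (repZ Hrho) -scalemxAr scalemx_sub //.
    case: (weight_trichotomy k) => [pk|zk|nk].
    - by apply: submx_trans (sv _ _ pk (b_wspace k)) _; apply: sub0mx.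
    - by rewrite (wspace_scal vt (b_H zk)) scalemx_sub.
    - by apply: submx_trans (submxMr _ vU) (sU _ _); exists k.
  apply/row_subP => i; rewrite row_mul; have /HT[uU ux] := row_sub i T.
  have ukU : (row i T *m rho (b k) <= U)%MS by apply: ux.
  apply/HT; split=> // x; rewrite -mulmxA (rep_comm Hrho) mulmxBr mulmxA.
  rewrite addmx_sub ?eqmx_opp ?ux //.
  by apply: submx_trans (submxMr _ (ux x)) (sU _ _); exists k.
exists U; split=> // [W iW vW|sigma u us uU].
  by apply: mU => // A [k _ ->]; apply: iW.
have [Q [sQ idQ imQ]] := weight_projector sigma.
(* The span of [v] and of all weight vectors of weight below [tau] is stable under lowering, so it
   contains [U]; the projector to weight [sigma] then yields the three cases. *)
pose S (u : 'rV[F]_n) := u = v \/ exists2 nu, (u <= wspace rho H nu)%MS & poscomb (tau - nu).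
have [T [ST mT]] := exists_span S.
have UT : (U <= T)%MS.
  apply: mU => [|A [k nk ->]]; first by apply: ST; left.
  apply: submx_trans (_ : (kermx (rho (b k) *m cokermx T) *m rho (b k) <= T)%MS); last first.
    by rewrite submxE -mulmxA mulmx_ker.
  apply: submxMr; apply: mT => y Sy; apply/sub_kermxP; rewrite mulmxA; apply/eqP.
  rewrite -submxE; apply: ST; right; case: Sy => [->|[nu yn pn]].
    exists (tau + w k); first exact: rep_wspace vt (b_wspace k).
    by apply: poscomb_weq nk => x xH; rewrite opprD addrA subrr add0r.
  exists (nu + w k); first exact: rep_wspace yn (b_wspace k).
  by have := poscomb_add pn nk; rewrite -addrA -opprD.
suff : [\/ weq H sigma tau /\ (u *m Q <= v)%MS, poscomb (tau - sigma) | u *m Q = 0].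
  by rewrite idQ.
case: (classic (poscomb (tau - sigma))) => pn; first by constructor 2.
case: (classic (weq H sigma tau)) => E; [constructor 1; split=> // | constructor 3].
  apply: (span_ind (Q := fun u => (u *m Q <= v)%MS) mT) (submx_trans uU UT).
  - by rewrite mul0mx sub0mx.
  - by move=> a x y Hx Hy; rewrite mulmxDl -scalemxAl addmx_sub ?scalemx_sub.
  - move=> y [->|[nu yn pnu]]; first by rewrite idQ // (wspace_weq rho E).
    rewrite (weight_projector0 sQ imQ _ yn) ?sub0mx // => En; apply: pn.
    by apply: poscomb_weq pnu => x xH; rewrite !wevalDl !wevalNl En.
apply: (span_ind (Q := fun u => u *m Q = 0) mT) (submx_trans uU UT).
- by rewrite mul0mx.
- by move=> a x y Hx Hy; rewrite mulmxDl -scalemxAl Hx Hy scaler0 addr0.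
- move=> y [->|[nu yn pnu]].
    by apply: (weight_projector0 sQ imQ _ vt) => /weq_sym.
  rewrite (weight_projector0 sQ imQ _ yn) // => En; apply: pn.
  by apply: poscomb_weq pnu => x xH; rewrite !wevalDl !wevalNl En.
Qed.

Definition hw_module tau v U :=
  [/\ v != 0, (v <= wspace rho H tau)%MS, singular 0 v, inv U & (v <= U)%MS] /\
  (forall W, inv W -> (v <= W)%MS -> (U <= W)%MS) /\
  (forall sigma u, (u <= wspace rho H sigma)%MS -> (u <= U)%MS ->
      [\/ weq H sigma tau /\ (u <= v)%MS, poscomb (tau - sigma) | u = 0]).

Lemma hw_module_exists tau v : v != 0 -> (v <= wspace rho H tau)%MS -> singular 0 v ->
  exists U, hw_module tau v U.
Proof. by move=> v0 vt sv; have [U [iU vU mU wU]] := cyc_exists vt sv; exists U. Qed.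

Lemma invariant0 : inv 0.
Proof. by move=> x; rewrite mul0mx. Qed.

Lemma singular0_dom tau v : v != 0 -> (v <= wspace rho H tau)%MS -> singular 0 v -> dom tau.
Proof. by move=> v0 vt sv; apply: singular_dom invariant0 vt sv _; rewrite submx0. Qed.

Lemma casimir_singular0 tau v : (v <= wspace rho H tau)%MS -> singular 0 v ->
  v *m casimir = cas tau *: v.
Proof.
move=> vt sv; have := casimir_singular invariant0 vt sv.
by rewrite submx0 subr_eq0 => /eqP.
Qed.

(** The kernel of [casimir - cas tau] is a submodule containing the generator [v]. *)
Lemma hw_module_casimir tau v U u : hw_module tau v U -> (u <= U)%MS ->
  u *m casimir = cas tau *: u.
Proof.
move=> [[v0 vt sv iU vU] [mU _]] uU; apply/eqP; rewrite -subr_eq0 -mul_mx_scalar -mulmxBr.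
rewrite -sub_kermx; apply: submx_trans uU _; apply: mU => [x|].
  apply: comm_mx_stable_ker; rewrite /comm_mx mulmxBl mulmxBr casimir_comm.
  by rewrite scalar_mxC.
by rewrite sub_kermx mulmxBr mul_mx_scalar (casimir_singular0 vt sv) subrr.
Qed.

(** The Casimir element acts on [u] by [cas sigma] and on all of [U] by [cas tau], so [cas_neq]
    excludes a [sigma] strictly below [tau]. *)
Lemma hw_module_singular tau v U sigma u : hw_module tau v U -> (u <= U)%MS ->
  (u <= wspace rho H sigma)%MS -> singular 0 u -> u != 0 -> weq H sigma tau /\ (u <= v)%MS.
Proof.
move=> hU uU us su u0; have [[v0 vt sv iU vU] [_ wU]] := hU.
have [//|lt|E] := wU _ _ us uU; last by rewrite E eqxx in u0.
have := cas_neq (singular0_dom v0 vt sv) (singular0_dom u0 us su) lt.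
have : cas sigma *: u = cas tau *: u.
  by rewrite -(casimir_singular0 us su) (hw_module_casimir hU uU).
move/eqP; rewrite -subr_eq0 -scalerBl scaler_eq0 (negPf u0) orbF subr_eq0 eq_sym.
by move=> ->.
Qed.

(** A nonzero submodule has a singular vector by [climb]; it is a multiple of [v], which generates
    [U]. *)
Lemma hw_module_irreducible tau v U : hw_module tau v U -> irreducible rho U.
Proof.
move=> hU; have [[v0 vt sv iU vU] [mU _]] := hU; split=> //.
  by apply: contraNneq v0 => U0; rewrite -submx0 -U0.
move=> V iV VU; have [->|V0] := eqVneq V 0; [by left | right].
have nV : ~~ (V <= (0 : 'M_n))%MS by rewrite submx0.
have [sigma [u [us uV u0 su]]] := climb (inv_Hstable iV) (fun k _ => iV (b k)) nV.
rewrite submx0 in u0.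
have [_ /sub_rVP[a Ea]] := hw_module_singular hU (submx_trans uV VU) us su u0.
have a0 : a != 0 by apply: contraNneq u0 => a0; rewrite Ea a0 scale0r.
rewrite /eqmx VU /=; apply: mU => //; apply: submx_trans uV.
by rewrite Ea eqmx_scale.
Qed.

Lemma hw_module_highest tau v U : hw_module tau v U ->
  highest_weight br H alpha rho U tau.
Proof.
move=> [[v0 vt sv iU vU] _]; exists v; split=> // a e [[an _] [m E]] ea.
apply/eqP; rewrite -submx0; apply: sv ea; exists m => //.
apply: NNPP => N; apply: an => x xH; rewrite E // weval0l weval_wcomb big1 // => i _.
by case: (eqVneq (m i) 0%N) => [->|mi]; [rewrite mul0r | case: N; exists i].
Qed.

(** * Complete reducibility with at most one singular line per weight *)

Hypothesis mult1 : forall tau v v', v != 0 -> (v <= wspace rho H tau)%MS -> singular 0 v ->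
  (v' <= wspace rho H tau)%MS -> singular 0 v' -> (v' <= v)%MS.

(** One singular vector is kept for each weight that carries one. Only weights from a finite list
    spanning the module occur, and repetitions are removed up to equality on [H], which makes the
    [tau i] distinct. *)
Lemma singular_list : exists (k : nat) (tau : 'I_k -> 'rV[F]_d) (v : 'I_k -> 'rV[F]_n),
  [/\ (forall i j, weq H (tau i) (tau j) -> i = j),
      (forall i, [/\ v i != 0, (v i <= wspace rho H (tau i))%MS & singular 0 (v i)]) &
      forall sigma u, u != 0 -> (u <= wspace rho H sigma)%MS -> singular 0 u ->
        exists i, weq H (tau i) sigma].
Proof.
have [s Hs] := Hw.
pose sing (p : 'rV[F]_d * 'rV[F]_n) :=
  [/\ p.2 != 0, (p.2 <= wspace rho H p.1)%MS & singular 0 p.2].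
have [L [pL sL cL]] : exists L : seq ('rV[F]_d * 'rV[F]_n),
    [/\ pairwise (fun p q => ~~ weqb p.1 q.1) L, (forall p, p \in L -> sing p) &
      forall sigma u, (exists2 nu, nu \in s & weq H nu sigma) -> sing (sigma, u) ->
        exists2 p, p \in L & weq H p.1 sigma].
  elim: s {Hs} => [|nu s [L [pL sL cL]]]; first by exists [::]; split=> // sigma u [].
  case: (classic (exists u, sing (nu, u) /\ ~ exists2 p, p \in L & weq H p.1 nu)) => [[u [su no]]|no].
    exists ((nu, u) :: L); split.
    - rewrite /= pL andbT; apply/allP => p pin /=; apply/negP => /weqP E; apply: no.
      by exists p => //; apply: weq_sym.
    - by move=> p; rewrite inE => /predU1P[->|/sL].
    - move=> sigma u' [nu']; rewrite inE => /predU1P[-> E|ns E] su'.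
        by exists (nu, u) => //; apply: mem_head.
      have [|p pL' Ep] := cL sigma u' _ su'; first by exists nu'.
      by exists p => //; rewrite inE pL' orbT.
  exists L; split=> // sigma u' [nu']; rewrite inE => /predU1P[-> E|ns E] su'; last first.
    by apply: cL su'; exists nu'.
  apply: NNPP => nop; apply: no; exists u'; split.
    by case: su' => /= u0 us su'; split=> //=; rewrite (wspace_weq rho E).
  by move=> [p pin Ep]; apply: nop; exists p => //; apply: weq_trans E.
exists (size L), (fun i => (tnth (in_tuple L) i).1), (fun i => (tnth (in_tuple L) i).2).
split=> [i j E|i|sigma u u0 us su].
- pose x0 := tnth (in_tuple L) i.
  have W i' j' : (i' < j')%N -> (j' < size L)%N -> ~~ weqb (nth x0 L i').1 (nth x0 L j').1.
    move=> ij jL; move/(pairwiseP x0): pL => /(_ i' j'); apply => //.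
    by rewrite inE (ltn_trans ij jL).
  have Ei q : tnth (in_tuple L) q = nth x0 L q by apply: tnth_nth.
  apply/val_inj; case: (ltngtP i j) => // ij; exfalso.
    by move/negP: (W _ _ ij (ltn_ord j)); apply; apply/weqP; rewrite -!Ei.
  by move/negP: (W _ _ ij (ltn_ord i)); apply; apply/weqP; rewrite -!Ei; apply: weq_sym.
- by apply: sL; apply: mem_tnth.
- have [nu ns E] : exists2 nu, nu \in s & weq H nu sigma.
    apply: NNPP => no; case/eqP: u0; have [Q [sQ idQ kQ]] := partial_weight_projector s sigma.
    rewrite -(idQ _ us).
    have : (u <= \sum_(nu <- s) wspace rho H nu)%MS by apply: submx_trans Hs; apply: submx1.
    move: u {us su}; apply: sumsmx_seq_ind => [|x y Hx Hy|nu ns x xn].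
    + by rewrite mul0mx.
    + by rewrite mulmxDl Hx Hy addr0.
    + by apply: (kQ nu x ns _ xn) => E; apply: no; exists nu.
  have [|p pin Ep] := cL sigma u _ (And3 u0 us su); first by exists nu.
  have /tnthP[i Ei] : p \in in_tuple L by [].
  by exists i; rewrite -Ei.
Qed.

Lemma casimir_prod_comm (I : Type) (s : seq I) (A : pred I) (c : I -> F) x :
  (\prod_(i <- s | A i) (casimir - (c i)%:M)) *m rho x =
  rho x *m \prod_(i <- s | A i) (casimir - (c i)%:M).
Proof.
apply: (big_ind (fun M : 'M[F]_n => M *m rho x = rho x *m M)).
- by rewrite mul1mx mulmx1.
- by move=> M M' E E'; rewrite -[_ * _]/(_ *m _) -mulmxA E' mulmxA E mulmxA.
- by move=> i _; rewrite mulmxBl mulmxBr casimir_comm scalar_mxC.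
Qed.

Section Decomposition.
Variables (k : nat) (tau : 'I_k -> 'rV[F]_d) (v : 'I_k -> 'rV[F]_n) (W : 'I_k -> 'M[F]_n).
Hypotheses (tau_inj : forall i j, weq H (tau i) (tau j) -> i = j)
  (hW : forall i, hw_module (tau i) (v i) (W i))
  (cov : forall sigma u, u != 0 -> (u <= wspace rho H sigma)%MS -> singular 0 u ->
        exists i, weq H (tau i) sigma).

Lemma W_inv i : inv (W i). Proof. by have [[]] := hW i. Qed.

Lemma sumW_inv (A : pred 'I_k) : inv (\sum_(i | A i) W i)%MS.
Proof.
move=> x; rewrite sumsmxMr; apply/sumsmx_subP => i Ai.
by apply: submx_trans (W_inv i x) _; apply: (sumsmx_sup i).
Qed.

Lemma singular_in_sum sigma u : (u <= wspace rho H sigma)%MS -> singular 0 u ->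
  (u <= \sum_i W i)%MS.
Proof.
move=> us su; have [->|u0] := eqVneq u 0; first exact: sub0mx.
have [i E] := cov u0 us su; have [[vi0 vt sv _ vW] _] := hW i.
apply: (sumsmx_sup i) => //; apply: submx_trans vW.
by apply: (mult1 vi0 _ sv us su); rewrite -(wspace_weq rho E).
Qed.

(* Were the sum N of the modules W i proper, there would be a vector of weight sigma
   singular modulo N; applying prod (Omega - c_i) over the Casimir values
   c_i <> c(sigma) makes it singular without leaving the complement of N. *)
Lemma sumW_full : (1%:M <= \sum_i W i)%MS.
Proof.
set N := (\sum_i W i)%MS; apply/negPn/negP => nN.
have iN : inv N := sumW_inv predT.
have [sigma [u [us _ uN su]]] := climb (U := 1%:M) (fun h _ => submx1 _) (fun l _ => submx1 _) nN.
have ds := singular_dom iN us su uN.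
pose A i := cas (tau i) != cas sigma.
pose q := \prod_(i | A i) (casimir - (cas (tau i))%:M).
have sq l : pos l -> u *m q *m rho (b l) = 0.
  move=> pl; rewrite -mulmxA casimir_prod_comm mulmxA.
  set e := u *m rho (b l).
  have pw := proj1 (Hpos l) pl.
  have es : (e *m q <= wspace rho H (sigma + w l))%MS.
    apply/(wspaceP Hrho) => h hH; rewrite -mulmxA casimir_prod_comm mulmxA.
    by rewrite (wspace_scal (rep_wspace us (b_wspace l)) hH) -scalemxAl.
  have [Q [sQ idQ imQ]] := weight_projector (sigma + w l).
  have eN : (e <= N)%MS := su _ _ pw (b_wspace l).
  rewrite -(idQ _ es); move: eN; rewrite /N; move: (e).
  apply: sumsmx_ind => [|x y Hx Hy|i _ x xW].
  - by rewrite !mul0mx.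
  - by rewrite !mulmxDl Hx Hy addr0.
  - have xq : x *m q = (\prod_(j | A j) (cas (tau i) - cas (tau j))) *: x.
      rewrite /q; apply: (big_ind2 (fun (M : 'M_n) a => x *m M = a *: x)).
      + by rewrite mulmx1 scale1r.
      + move=> M a M' a' E E'; rewrite -[M * M']/(M *m M') mulmxA E -scalemxAl E'.
        by rewrite scalerA.
      + by move=> j _; rewrite mulmxBr mul_mx_scalar (hw_module_casimir (hW i) xW) scalerBl.
    case: (boolP (A i)) => Ai.
      by rewrite xq (bigD1 i) //= subrr mul0r scale0r mul0mx.
    rewrite xq -scalemxAl; suff -> : x *m Q = 0 by rewrite scaler0.
    have xQW : (x *m Q <= W i)%MS.
      by apply: submx_trans (submxMr _ xW) _; apply/sQ/inv_Hstable/W_inv.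
    have [[vi0 vt sv _ _] [_ wW]] := hW i.
    have di := singular0_dom vi0 vt sv.
    (* A nonzero component of weight [sigma + w l] in [W i] puts [tau i] strictly above [sigma],
       against the equality of their Casimir values. *)
    have [[E _]|lt|//] := wW _ _ (imQ x) xQW; case/negP: Ai; apply: cas_neq => //.
      by apply: poscomb_weq pw => y yH; rewrite wevalDl -E // !wevalDl wevalNl addrC addKr.
    by apply: poscomb_weq (poscomb_add lt pw) => y yH; rewrite opprD addrA subrK.
have [uq_mod _] : (u *m q - (\prod_(i | A i) (cas sigma - cas (tau i))) *: u <= N)%MS /\ stablemx N q.
  have stc : stablemx N casimir.
    rewrite /casimir mulmx_sumr; apply: summx_sub => l _.
    by apply: stablemxM; apply: iN.
  rewrite /q; apply: (big_ind2 (fun (M : 'M_n) a => (u *m M - a *: u <= N)%MS /\ stablemx N M)).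
  - by rewrite mulmx1 scale1r subrr sub0mx mulmx1.
  - move=> M a M' a' [E sM] [E' sM']; split; last exact: stablemxM.
    have -> : u *m (M * M') - (a * a') *: u = (u *m M - a *: u) *m M' + a *: (u *m M' - a' *: u).
      by rewrite mulmxBl scalerBr scalerA -scalemxAl -mulmxA addrA subrK.
    by rewrite addmx_sub ?scalemx_sub //; apply: submx_trans (submxMr _ E) sM'.
  - move=> j _; split; last first.
      by rewrite mulmxBr mul_mx_scalar addmx_sub ?eqmx_opp ?scalemx_sub.
    have -> : u *m (casimir - (cas (tau j))%:M) - (cas sigma - cas (tau j)) *: u =
      u *m casimir - cas sigma *: u.
      by rewrite mulmxBr mul_mx_scalar scalerBl opprB addrA; congr (_ - _); apply: subrK.
    exact: casimir_singular.
have uqs : (u *m q <= wspace rho H sigma)%MS.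
  apply/(wspaceP Hrho) => h hH; rewrite -mulmxA casimir_prod_comm mulmxA.
  by rewrite (wspace_scal us hH) -scalemxAl.
have uqN : (u *m q <= N)%MS.
  apply: singular_in_sum uqs _; apply: singularP => l pl.
  by rewrite sq // sub0mx.
case/negP: uN; have : ((\prod_(i | A i) (cas sigma - cas (tau i))) *: u <= N)%MS.
  by rewrite -[X in (X <= N)%MS](subKr (u *m q)) addmx_sub ?eqmx_opp.
by rewrite eqmx_scale //; apply/prodf_neq0 => i Ai; rewrite subr_eq0 eq_sym.
Qed.

(** Induction on the size of [A]: drop some [j], and let [S] be the sum over the rest. Since [v i]
    is not in [S], the irreducible [W j] meets [S] in 0, so the component of [v i] in [W j] is
    singular of weight [tau i]. Singular weight vectors of [W j] have weight [tau j], so this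
    component is 0 and [v i] lies in [S], a contradiction. *)
Lemma simple_not_in_others m (A : {set 'I_k}) i : #|A| = m -> i \notin A ->
  ~~ (v i <= \sum_(j in A) W j)%MS.
Proof.
have [[vi0 vt sv _ _] _] := hW i.
elim: m A => [|m IH] A cA iA; apply/negP => vA.
  move: vA; rewrite big_pred0; first by rewrite submx0 (negPf vi0).
  by move=> j; move/eqP: cA; rewrite cards_eq0 => /eqP->; rewrite inE.
have [j jA] : exists j, j \in A by apply/set0Pn; rewrite -card_gt0 cA.
have ij : i != j by apply: contraNneq iA => ->.
pose A' := A :\ j; have cA' : #|A'| = m by move: cA; rewrite (cardsD1 j) jA => -[].
have iA' : i \notin A' by rewrite !inE negb_and iA orbT.
have EA : (\sum_(l in A) W l <= W j + \sum_(l in A') W l)%MS.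
  apply/sumsmx_subP => l lA; have [->|lj] := eqVneq l j; first exact: addsmxSl.
  by apply: submx_trans (addsmxSr _ _); apply: (sumsmx_sup l) => //; rewrite !inE lj.
have := submx_trans vA EA; set S := (\sum_(l in A') W l)%MS => vjS.
have iS : inv S := sumW_inv (mem A').
have nS : ~~ (v i <= S)%MS by apply: IH.
have cap0 : (W j :&: S)%MS = 0.
  have [_ _ irr] := hw_module_irreducible (hW j).
  have icap : inv (W j :&: S)%MS.
    move=> x; rewrite sub_capmx (submx_trans (submxMr _ (capmxSl _ _)) (W_inv j x)) /=.
    exact: submx_trans (submxMr _ (capmxSr _ _)) (iS x).
  case: (irr _ icap (capmxSl _ _)) => [/eqP //|/andP[_ Wcap]]; case/negP: nS.
  have WS : (W j <= S)%MS by apply: submx_trans Wcap (capmxSr _ _).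
  by apply: submx_trans vjS _; rewrite addsmx_sub WS submx_refl.
case/sub_addsmxP: vjS => -[x1 x2] /= Ev.
have [Q [sQ idQ imQ]] := weight_projector (tau i).
pose u := x1 *m W j *m Q; pose y := x2 *m S *m Q.
have Euy : v i = u + y by rewrite -(idQ _ vt) Ev mulmxDl.
have uW : (u <= W j)%MS.
  by apply: submx_trans (submxMr _ (submxMl _ _)) _; apply/sQ/inv_Hstable/W_inv.
have yS : (y <= S)%MS.
  by apply: submx_trans (submxMr _ (submxMl _ _)) _; apply/sQ/inv_Hstable.
have us : singular 0 u.
  apply: singularP => l /Hpos pl; rewrite -cap0 sub_capmx.
  rewrite (submx_trans (submxMr _ uW) (W_inv j _)) /=.
  have : v i *m rho (b l) = 0 by apply/eqP; rewrite -submx0; apply: sv (b_wspace l).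
  rewrite Euy mulmxDl => /eqP; rewrite addr_eq0 => /eqP ->.
  by rewrite eqmx_opp; apply: submx_trans (submxMr _ yS) (iS _).
have u0 : u = 0.
  apply/eqP/negPn/negP => u0; have [E _] := hw_module_singular (hW j) uW (imQ _) us u0.
  by rewrite (tau_inj E) eqxx in ij.
by case/negP: nS; rewrite Euy u0 add0r.
Qed.

Lemma sumW_direct : mxdirect (\sum_i W i).
Proof.
apply/mxdirect_sumsP => i _; have [_ _ irr] := hw_module_irreducible (hW i).
set S := (\sum_(j | _) _)%MS; have iS : inv S := sumW_inv _.
have icap : inv (W i :&: S)%MS.
  move=> x; rewrite sub_capmx (submx_trans (submxMr _ (capmxSl _ _)) (W_inv i x)) /=.
  exact: submx_trans (submxMr _ (capmxSr _ _)) (iS x).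
case: (irr _ icap (capmxSl _ _)) => [/eqP //|/andP[_ Wcap]].
have [[_ _ _ _ viW] _] := hW i.
have vS : (v i <= S)%MS by apply: submx_trans (submx_trans viW Wcap) (capmxSr _ _).
have nv : ~~ (v i <= \sum_(j in [set~ i]) W j)%MS.
  by apply: (simple_not_in_others erefl); rewrite !inE eqxx.
case/negP: nv; rewrite (eq_bigl (fun j => j != i)) // => j.
by rewrite !inE.
Qed.

End Decomposition.

Theorem multiplicity_free_decomposition :
  exists (k : nat) (tau : 'I_k -> 'rV[F]_d) (W : 'I_k -> 'M[F]_n),
    [/\ (forall i j, weq H (tau i) (tau j) -> i = j),
        (forall i, exists u, [/\ u != 0, (u <= wspace rho H (tau i))%MS & singular 0 u]),
        (forall i, irreducible rho (W i) /\ highest_weight br H alpha rho (W i) (tau i)),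
        (\sum_(i < k) W i == 1%:M)%MS &
        mxdirect (\sum_(i < k) W i)].
Proof.
have [k [tau [v [tau_inj vs cov]]]] := singular_list.
have Wex i : exists W, hw_module (tau i) (v i) W.
  by have [v0 vt sv] := vs i; apply: hw_module_exists.
have [W hW] := fin_all_exists Wex; exists k, tau, W; split=> //.
- by move=> i; exists (v i).
- by move=> i; split; [apply: hw_module_irreducible | apply: hw_module_highest].
- by rewrite /eqmx submx1 (sumW_full hW cov).
- exact: sumW_direct tau_inj hW.
Qed.

End WeightModule.

(** * Tensor products *)

Section IrreducibleModule.
Variables (n : nat) (rho : 'rV[F]_d -> 'M[F]_n) (Hrho : is_rep br rho).

Lemma wspaces_span_invariant (s : seq 'rV[F]_d) :
  (forall nu, (wspace rho H nu <= \sum_(x <- s) wspace rho H x)%MS) ->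
  Defs.invariant rho (\sum_(x <- s) wspace rho H x)%MS.
Proof.
move=> Hs x; apply/row_subP => i; rewrite row_mul.
move: (row i _) (row_sub i (\sum_(x <- s) wspace rho H x)%MS).
apply: sumsmx_seq_ind => [|u v uN vN|nu _ v vn].
- by rewrite mul0mx sub0mx.
- by rewrite mulmxDl addmx_sub.
rewrite [x]expand_b (rep_sum Hrho) mulmx_sumr; apply: summx_sub => k _.
rewrite (repZ Hrho) -scalemxAr scalemx_sub //.
exact: submx_trans (rep_wspace Hrho vn (b_wspace k)) (Hs _).
Qed.

Hypothesis Hirr : irreducible rho 1%:M.

Lemma irreducible_full (U : 'M[F]_n) : Defs.invariant rho U -> U != 0 -> (1%:M <= U)%MS.
Proof.
have [_ _ irr] := Hirr; move=> iU U0.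
by case: (irr U iU (submx1 _)) => [E|/andP[_]//]; rewrite E in U0.
Qed.

Lemma irreducible_wmod lam (v : 'rV[F]_n) : v != 0 -> (v <= wspace rho H lam)%MS -> wmod rho.
Proof.
move=> v0 vl; have [s Hs] := exists_finite_sum (fun nu => wspace rho H nu).
exists s; apply: irreducible_full; first exact: wspaces_span_invariant.
apply: contraNneq v0 => E; rewrite -submx0 -E; exact: submx_trans vl (Hs lam).
Qed.

Lemma highest_weight_singular lam : highest_weight br H alpha rho 1%:M lam ->
  exists v, [/\ v != 0, (v <= wspace rho H lam)%MS & singular rho 0 v].
Proof.
move=> [v [v0 _ vl hv]]; exists v; split=> //; apply: (singularP Hrho) => k /Hpos pk.
rewrite submx0; apply/eqP/hv; last exact: b_wspace.
split; last by have [m _ E] := pk; exists m.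
by apply: b_root => E; apply: poscomb_n0 pk.
Qed.

Lemma irreducible_singular lam (v : 'rV[F]_n) sigma (u : 'rV[F]_n) :
  v != 0 -> (v <= wspace rho H lam)%MS -> singular rho 0 v ->
  u != 0 -> (u <= wspace rho H sigma)%MS -> singular rho 0 u -> (u <= v)%MS.
Proof.
move=> v0 vl sv u0 us su; have Hw := irreducible_wmod v0 vl.
have [U hU] := hw_module_exists Hrho Hw v0 vl sv.
have [[_ _ _ iU vU] _] := hU.
have U0 : U != 0 by apply: contraNneq v0 => E; rewrite -submx0 -E.
have uU : (u <= U)%MS by apply: submx_trans (submx1 _) (irreducible_full iU U0).
by have [] := hw_module_singular Hrho hU uU us su u0.
Qed.

(** [phi] is the projector to weight [lam] followed by a functional equal to 1 on [v]. The projector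
    makes it a weight vector for the transposed action of [H], so that contracting with it lowers
    weights by [lam]. *)
Lemma highest_weight_functional lam (v : 'rV[F]_n) :
  v != 0 -> (v <= wspace rho H lam)%MS -> singular rho 0 v ->
  exists phi : 'cV[F]_n, v *m phi = 1%:M /\
    forall h, (h <= H)%MS -> rho h *m phi = weval lam h *: phi.
Proof.
move=> v0 vl sv; have Hw := irreducible_wmod v0 vl.
have [Q [sQ idQ imQ]] := weight_projector Hrho Hw lam.
have fv : row_free v by rewrite /row_free rank_rV v0.
exists (Q *m pinvmx v); split; first by rewrite mulmxA idQ // mulmxVp.
move=> h hH; rewrite mulmxA scalemxAl; congr (_ *m _).
apply/row_matrixP => i; rewrite !rowE -!scalemxAr mulmxA.
have [s Hs] := Hw; have : ((delta_mx 0 i : 'rV_n) <= \sum_(nu <- s) wspace rho H nu)%MS.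
  by apply: submx_trans Hs; apply: submx1.
move: (delta_mx 0 i); apply: sumsmx_seq_ind => [|x y Hx Hy|nu _ x xn].
- by rewrite !mul0mx scaler0.
- by rewrite !mulmxDl Hx Hy scalerDr.
rewrite (wspace_scal Hrho xn hH) -scalemxAl.
case: (classic (weq H nu lam)) => E; first by rewrite E.
by rewrite (weight_projector0 Hrho sQ imQ E xn) !scaler0.
Qed.

End IrreducibleModule.

(** * Contraction of singular tensors *)

Section Tensor.
Variables (n1 n2 : nat) (rho1 : 'rV[F]_d -> 'M[F]_n1) (rho2 : 'rV[F]_d -> 'M[F]_n2).
Hypotheses (Hrho1 : is_rep br rho1) (Hrho2 : is_rep br rho2).
Notation tensor := (tensor_rep rho1 rho2).

Lemma tensorE x (A : 'M[F]_(n1, n2)) :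
  mxvec A *m tensor x = mxvec ((rho1 x)^T *m A + A *m rho2 x).
Proof.
rewrite mul_lin1_mx ?mxvecK // => a u v.
by rewrite [vec_mx _]linearP mulmxDr mulmxDl -scalemxAr -scalemxAl addrACA -scalerDr linearP.
Qed.

Lemma tensor_is_rep : is_rep br tensor.
Proof.
have E (M M' : 'M[F]_(n1 * n2)) : (forall A, mxvec A *m M = mxvec A *m M') -> M = M'.
  move=> HM; apply/row_matrixP => i; rewrite !rowE -[delta_mx 0 i]vec_mxK.
  exact: HM.
split=> [a x y|x y v].
  apply: E => A; rewrite mulmxDr -scalemxAr !tensorE (rep_lin Hrho1) (rep_lin Hrho2).
  by rewrite linearP /= mulmxDl mulmxDr -scalemxAl -scalemxAr addrACA -scalerDr linearP.
rewrite /act -[v]vec_mxK !tensorE -linearB /=; congr mxvec; move: (vec_mx v) => A.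
rewrite (rep_br Hrho1) (rep_br Hrho2) linearB /= !trmx_mul mulmxBl mulmxBr.
rewrite !mulmxDr !mulmxDl !mulmxA.
have addC4 (V : zmodType) (x1 x2 x3 x4 : V) : x1 + x2 + (x3 + x4) = x1 + x4 + (x2 + x3).
  by rewrite [x3 + x4]addrC addrACA.
rewrite (addC4 _ _ _ _ (A *m rho2 y *m rho2 x)) (addC4 _ _ _ _ (A *m rho2 x *m rho2 y)).
rewrite [in X in _ = _ - X](addrC ((rho1 y)^T *m A *m rho2 x)).
by rewrite opprD [RHS]addrACA subrr addr0 opprD addrACA.
Qed.

Lemma tensor_wspace nu1 nu2 (u1 : 'rV[F]_n1) (u2 : 'rV[F]_n2) :
  (u1 <= wspace rho1 H nu1)%MS -> (u2 <= wspace rho2 H nu2)%MS ->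
  (mxvec (u1^T *m u2) <= wspace tensor H (nu1 + nu2))%MS.
Proof.
move=> u1n u2n; apply/(wspaceP tensor_is_rep) => h hH; rewrite tensorE.
rewrite mulmxA -trmx_mul (wspace_scal Hrho1 u1n hH) -mulmxA (wspace_scal Hrho2 u2n hH).
by rewrite linearZ /= -scalemxAl -scalemxAr -scalerDl -wevalDl linearZ.
Qed.

Lemma tensor_wmod : wmod rho1 -> wmod rho2 -> wmod tensor.
Proof.
move=> [s1 Hs1] [s2 Hs2]; have [s Hs] := exists_finite_sum (fun nu => wspace tensor H nu).
exists s; set N := (\sum_(x <- s) _)%MS in Hs *.
have pure (u1 : 'rV_n1) (u2 : 'rV_n2) : (mxvec (u1^T *m u2) <= N)%MS.
  have : (u1 <= \sum_(nu <- s1) wspace rho1 H nu)%MS by apply: submx_trans Hs1; apply: submx1.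
  move: u1; apply: sumsmx_seq_ind => [|u v uN vN|nu1 _ u1 u1n].
  - by rewrite trmx0 mul0mx linear0 sub0mx.
  - by rewrite linearD mulmxDl linearD addmx_sub.
  have : (u2 <= \sum_(nu <- s2) wspace rho2 H nu)%MS by apply: submx_trans Hs2; apply: submx1.
  move: u2; apply: sumsmx_seq_ind => [|u v uN vN|nu2 _ u2 u2n].
  - by rewrite mulmx0 linear0 sub0mx.
  - by rewrite mulmxDr linearD addmx_sub.
  exact: submx_trans (tensor_wspace u1n u2n) (Hs _).
apply/row_subP => l; rewrite -[row l _]vec_mxK; move: (vec_mx _) => A.
have -> : A = \sum_i (delta_mx 0 i)^T *m row i A.
  apply/matrixP => i j; rewrite summxE (bigD1 i) //= !mxE big_ord1 !mxE !eqxx mul1r.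
  rewrite big1 ?addr0 // => i' ii'; rewrite !mxE big_ord1 !mxE eqxx /=.
  by rewrite eq_sym (negPf ii') mul0r.
by rewrite linear_sum; apply: summx_sub => i _; apply: pure.
Qed.

Variables (lam : 'rV[F]_d) (v : 'rV[F]_n2).
Hypotheses (Hirr2 : irreducible rho2 1%:M) (v0 : v != 0)
  (vl : (v <= wspace rho2 H lam)%MS) (sv : singular rho2 0 v).
Variable phi : 'cV[F]_n2.
Hypotheses (vphi : v *m phi = 1%:M)
  (Hphi : forall h, (h <= H)%MS -> rho2 h *m phi = weval lam h *: phi).

Lemma tensor_phi_wspace tau (A : 'M[F]_(n1, n2)) :
  (mxvec A <= wspace tensor H tau)%MS -> ((A *m phi)^T <= wspace rho1 H (tau - lam))%MS.
Proof.
move=> At; apply/(wspaceP Hrho1) => h hH.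
have := wspace_scal tensor_is_rep At hH; rewrite tensorE -linearZ /=.
move/(can_inj mxvecK) => /(congr1 (fun B => (B *m phi)^T)).
rewrite mulmxDl -!mulmxA Hphi // -scalemxAl -scalemxAr linearD /= trmx_mul trmxK.
have trZ a (B : 'cV[F]_n1) : (a *: B)^T = a *: B^T by rewrite linearZ.
by rewrite !trZ => E; rewrite wevalDl wevalNl scalerBl -E addrK.
Qed.

(* The row space of A is a submodule of rho2 for the Borel subalgebra. *)
Lemma tensor_phi_neq0 tau (A : 'M[F]_(n1, n2)) : A != 0 ->
  (mxvec A <= wspace tensor H tau)%MS -> singular tensor 0 (mxvec A) -> A *m phi != 0.
Proof.
move=> A0 At sA; apply/eqP => Aphi.
(* If [x] acts on the tensor [A] by a scalar, [A *m rho2 x] is a combination of [A] and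
   [(rho1 x)^T *m A], whose rows lie in the row space of [A]. *)
have stab x : (exists c, (rho1 x)^T *m A + A *m rho2 x = c *: A) ->
    stablemx <<A>>%MS (rho2 x).
  case=> c E; rewrite (eqmxMr _ (genmxE _)) genmxE.
  have -> : A *m rho2 x = c *: A - (rho1 x)^T *m A by rewrite -E addrC addKr.
  by rewrite addmx_sub ?eqmx_opp ?scalemx_sub ?submxMl.
have sH : Hstable rho2 <<A>>%MS.
  move=> h hH; apply: stab; exists (weval tau h); apply: (can_inj mxvecK).
  by rewrite -tensorE (wspace_scal tensor_is_rep At hH) linearZ.
have sP k : pos k -> stablemx <<A>>%MS (rho2 (b k)).
  move=> /Hpos pk; apply: stab; exists 0; apply: (can_inj mxvecK).
  rewrite -tensorE scale0r linear0; apply/eqP; rewrite -submx0.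
  exact: sA pk (b_wspace k).
have nA : ~~ (<<A>>%MS <= (0 : 'M_n2))%MS by rewrite genmxE submx0.
have [sigma [u [us uA u0 su]]] := climb Hrho2 (irreducible_wmod Hrho2 Hirr2 v0 vl) sH sP nA.
rewrite submx0 in u0; rewrite genmxE in uA.
have vu := irreducible_singular Hrho2 Hirr2 u0 us su v0 vl sv.
have /submxP[c Ec] := submx_trans vu uA.
move: vphi; rewrite Ec -mulmxA Aphi mulmx0 => /matrixP/(_ 0 0)/eqP.
by rewrite !mxE eq_sym oner_eq0.
Qed.

Hypothesis Hmult : forall nu, (wmult rho1 H nu > 0)%N -> wmult rho1 H nu = 1%N.

(** Both contractions lie in one weight space of [rho1], of dimension 1, so some [A' - a *: A] has
    contraction 0; being singular of weight [tau], it vanishes by [tensor_phi_neq0]. *)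
Lemma tensor_mult1 tau (z z' : 'rV[F]_(n1 * n2)) : z != 0 ->
  (z <= wspace tensor H tau)%MS -> singular tensor 0 z ->
  (z' <= wspace tensor H tau)%MS -> singular tensor 0 z' -> (z' <= z)%MS.
Proof.
rewrite -[z]vec_mxK -[z']vec_mxK; move: (vec_mx z) (vec_mx z') => A A' A0 At sA At' sA'.
have {}A0 : A != 0 by apply: contraNneq A0 => ->; rewrite linear0.
have x0 := tensor_phi_neq0 A0 At sA.
have xs := tensor_phi_wspace At; have xs' := tensor_phi_wspace At'.
have xT0 : (A *m phi)^T != 0 by rewrite trmx_eq0.
have r1 : \rank (wspace rho1 H (tau - lam)) = 1%N.
  apply: Hmult; rewrite /wmult lt0n mxrank_eq0.
  by apply: contraNneq xT0 => E; rewrite -submx0 -E.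
have /sub_rVP[a Ea] : ((A' *m phi)^T <= (A *m phi)^T)%MS.
  apply: submx_trans xs' _.
  by rewrite -(geq_leqif (mxrank_leqif_sup xs)) r1 rank_rV xT0.
have B0 : (A' - a *: A) *m phi = 0.
  by apply: trmx_inj; rewrite mulmxBl -scalemxAl linearB linearZ /= Ea subrr trmx0.
suff /eqP : A' - a *: A = 0.
  by rewrite subr_eq0 => /eqP ->; rewrite linearZ scalemx_sub.
apply/eqP/negPn/negP => nB.
suff : (A' - a *: A) *m phi != 0 by rewrite B0 eqxx.
apply: (tensor_phi_neq0 nB (tau := tau)).
  by rewrite linearB linearZ /= addmx_sub ?eqmx_opp ?scalemx_sub.
move=> nu x pn xn; rewrite linearB linearZ /= mulmxBl -scalemxAl.
by rewrite addmx_sub ?eqmx_opp ?scalemx_sub //; [apply: sA' pn xn | apply: sA pn xn].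
Qed.

End Tensor.

Theorem tensor_decomposition n1 (rho1 : 'rV[F]_d -> 'M[F]_n1) n2 (rho2 : 'rV[F]_d -> 'M[F]_n2) mu lam :
  is_rep br rho1 -> irreducible rho1 1%:M -> highest_weight br H alpha rho1 1%:M mu ->
  is_rep br rho2 -> irreducible rho2 1%:M -> highest_weight br H alpha rho2 1%:M lam ->
  (forall nu, (wmult rho1 H nu > 0)%N -> wmult rho1 H nu = 1%N) ->
  exists (k : nat) (tau : 'I_k -> 'rV[F]_d) (W : 'I_k -> 'M[F]_(n1 * n2)),
    [/\ (forall i j, weq H (tau i) (tau j) -> i = j),
        (forall i, dominant alpha t (tau i) /\
           exists nu, (wmult rho1 H nu > 0)%N /\ weq H (tau i) (lam + nu)),
        (forall i, irreducible (tensor_rep rho1 rho2) (W i) /\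
           highest_weight br H alpha (tensor_rep rho1 rho2) (W i) (tau i)),
        (\sum_(i < k) W i == 1%:M)%MS &
        mxdirect (\sum_(i < k) W i)].
Proof.
move=> R1 I1 /(highest_weight_singular R1)[v1 [v10 v1l sv1]] R2 I2.
move=> /(highest_weight_singular R2)[v [v0 vl sv]] Hmult.
have [phi [vphi Hphi]] := highest_weight_functional R2 I2 v0 vl sv.
have RT := tensor_is_rep R1 R2.
have wT := tensor_wmod R1 R2 (irreducible_wmod R1 I1 v10 v1l) (irreducible_wmod R2 I2 v0 vl).
have m1 := tensor_mult1 R1 R2 I2 v0 vl sv vphi Hphi Hmult.
have [k [tau [W [inj sing irr full dir]]]] := multiplicity_free_decomposition RT wT m1.
exists k, tau, W; split=> // i; have [u [u0 us su]] := sing i.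
split; first by refine (singular0_dom RT u0 us su).
(* The contraction of the singular vector [u] is a nonzero vector of this weight in [rho1]. *)
exists (tau i - lam); split; last by move=> x _; rewrite addrC subrK.
have A0 : vec_mx u != 0 by apply: contraNneq u0 => E; rewrite -[u]vec_mxK E linear0.
rewrite -[u]vec_mxK in us su.
have xs := tensor_phi_wspace R1 R2 Hphi us.
have x0 := tensor_phi_neq0 R1 R2 I2 v0 vl sv vphi A0 us su.
rewrite /wmult lt0n mxrank_eq0; apply: contraNneq x0 => E.
by rewrite -trmx_eq0 -submx0 -E.
Qed.

End Lie.

Theorem mainTheorem5
  (F : closedFieldType) (charF0 : [pchar F] =i pred0)
  (d : nat) (br : 'rV[F]_d -> 'rV[F]_d -> 'rV[F]_d)
  (Hlie : is_lie_bracket br) (Hss : semisimple br)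
  (H : 'M[F]_d) (HH : cartan br H)
  (r : nat) (alpha : 'I_r -> 'rV[F]_d) (Hbase : is_base br H alpha)
  (t : 'I_r -> 'rV[F]_d) (Ht : forall j, killing_dual br H (alpha j) (t j))
  (mu : 'rV[F]_d) (Hmu : dominant alpha t mu)
  (n1 : nat) (rho1 : 'rV[F]_d -> 'M[F]_n1) (Hrho1 : is_rep br rho1)
  (Hirr1 : irreducible rho1 1%:M) (Hhw1 : highest_weight br H alpha rho1 1%:M mu)
  (Hweights : forall nu : 'rV[F]_d, (wmult rho1 H nu > 0)%N ->
     [/\ wmult rho1 H nu = 1%N,
         (forall i, int_ge (wcoord alpha t nu i) (-2)),
         (forall i j, wcoord alpha t nu i = -2 -> wcoord alpha t nu j = -2 -> i = j) &
         (forall i, wcoord alpha t nu i = -2 -> forall j, j != i ->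
             is_nat (wcoord alpha t nu j) /\ int_ge (cartan_mx alpha t i j) (-1))])
  (lam : 'rV[F]_d) (Hlam : dominant alpha t lam)
  (n2 : nat) (rho2 : 'rV[F]_d -> 'M[F]_n2) (Hrho2 : is_rep br rho2)
  (Hirr2 : irreducible rho2 1%:M) (Hhw2 : highest_weight br H alpha rho2 1%:M lam) :
  exists (k : nat) (tau : 'I_k -> 'rV[F]_d) (W : 'I_k -> 'M[F]_(n1 * n2)),
    [/\ (forall i j, weq H (tau i) (tau j) -> i = j),
        (forall i, dominant alpha t (tau i) /\
           exists nu, (wmult rho1 H nu > 0)%N /\ weq H (tau i) (lam + nu)),
        (forall i, irreducible (tensor_rep rho1 rho2) (W i) /\
           highest_weight br H alpha (tensor_rep rho1 rho2) (W i) (tau i)),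
        (\sum_(i < k) W i == 1%:M)%MS &
        mxdirect (\sum_(i < k) W i)].
Proof.
have [P [w [Pu Pw]]] := weight_basis Hlie HH.
have [g [gH Hg]] := dual_simple_roots Hbase.
have [b' Hb'] := dual_basis_exists Hlie Hss Pu.
(* Sums over positive roots are indexed by a Boolean predicate; classical logic decides [poscomb] on
   the finitely many [w k]. *)
have [pos Hpos] : exists pos : 'I_d -> bool, forall k, pos k <-> poscomb H alpha (w k).
  suff : forall k, exists b : bool, b <-> poscomb H alpha (w k) by apply: fin_all_exists.
  by move=> k; case: (classic (poscomb H alpha (w k))); [exists true | exists false].
apply: (tensor_decomposition charF0 Hlie Hss HH Pu Pw Hbase Ht gH Hg Hb' Hpos
  Hrho1 Hirr1 Hhw1 Hrho2 Hirr2 Hhw2) => nu /Hweights[].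
by [].
Qed.
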